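(* Let $f:\mathbb{N}\to \mathbb{C}$ be a bounded function with $f(1)=0$. Then \[ \lim_{x\to \infty} \left(\frac{\sum_{1\le n\leq x} f(P^+(n))/n}{\sum_{1\le n\le x}1/n}- \frac{1}{|\{n\in\mathbb{N}:1\le n\le x\}|}\sum_{1\leq n\leq x} f(P^+(n))\right)=0 \] if and only if \[ \lim_{x\to \infty}\frac{1}{\log x}\sum_{n\leq x} \frac{\mu(n)\log n }{n}f(P^-(n))=0. \]
   Context: Here $\mathbb{N}=\{1,2,3,\dots\}$ and $\mu$ is the Möbius function. For an integer $n\ge 2$, $P^-(n)$ and $P^+(n)$ denote the smallest and the largest prime factor of $n$, respectively, and $P^-(1)=P^+(1)=1$. Sums $\sum_{n\le x}$ run over positive integers $n\le x$, with $x$ real. *)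

(* Defs.v *)
From HB Require Import structures.
From mathcomp Require Import all_boot all_order all_algebra finmap.
From mathcomp Require Import all_classical all_reals all_analysis.
From mathcomp Require Export complex.

Set Implicit Arguments.
Unset Strict Implicit.
Unset Printing Implicit Defensive.

Import Order.TTheory GRing.Theory Num.Theory.
Import numFieldNormedType.Exports.

Local Open Scope classical_set_scope.
Local Open Scope ring_scope.

(* The topology of [R[i]] is the one given by its norm [`|z|], which the
   library only attaches to the regular module [R[i]^o]. *)
HB.instance Definition _ (R : realType) := NormedModule.copy R[i] R[i]^o.

(* Only meaningful for [0 < n]; [moebius 0 = 1] is a junk value. *)
Definition moebius (n : nat) : int :=
  if all (fun p => ~~ (p ^ 2 %| n)%N) (primes n)
  then (-1) ^+ size (primes n) else 0.

(* [\sum_(n \in pos_le x) F n] and [#|` fset_set (pos_le x)|] have their usual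
   meaning because [pos_le x] is finite (see the lemmas below); for [x < 1] it
   is empty. *)
Definition pos_le (R : realType) (x : R) : set nat :=
  [set n | (1 <= n)%N /\ n%:R <= x].

Lemma pos_leE (R : realType) (x : R) :
  pos_le x = [set` index_iota 1 (Num.truncn x).+1].
Proof.
apply/seteqP; split=> n /=; rewrite mem_index_iota ltnS.
  by move=> [n1 nx]; rewrite n1 /= truncn_ge_nat// (le_trans _ nx).
move=> /andP[n1 nx]; split=> //.
have x0 : 0 <= x.
  by apply: contraTT (leq_trans n1 nx); rewrite truncn_gt0 -!ltNge => /lt_trans->.
by rewrite -truncn_ge_nat.
Qed.

Lemma finite_pos_le (R : realType) (x : R) : finite_set (pos_le x).
Proof. by rewrite pos_leE; exact: finite_seq. Qed.

Lemma sum_pos_leE (R : realType) (V : nmodType) (x : R) (F : nat -> V) :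
  \sum_(n \in pos_le x) F n = \sum_(1 <= n < (Num.truncn x).+1) F n.
Proof. by rewrite pos_leE -fsbig_seq// iota_uniq. Qed.

Lemma card_pos_le (R : realType) (x : R) :
  #|` fset_set (pos_le x)| = Num.truncn x.
Proof.
have := sum_pos_leE x (fun=> 1%N).
rewrite (fsbig_finite _ _ (finite_pos_le x)) sum_nat_const_nat muln1 subn1/=.
by move=> <-; rewrite card_fset_sum1.
Qed.

(* Main.v *)
(* Write g(d) = mu(d) f(P^-(d)) and E(N) = (1/N) sum_(d <= N) g(d) {N/d}.
   Alladi's duality, sum_(d %| n) g(d) = - f(P^+(n)), turns both averages of
   f(P^+(n)) into sums over d, and their difference is
     (1/ln N) sum_(n <= N) g(n) ln n / n - E(N) + O(1/ln N).
   So it suffices that E(N) -> 0 for every bounded f. This contains the prime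
   number theorem (take f = 1 off 1) in the form M(N) = o(N), where
   M(N) = sum_(n <= N) mu(n), and it follows from it: the integers all of whose
   prime factors exceed y have density prod_(p <= y) (1 - 1/p), which is small,
   and for fixed y the sum of mu over those integers is o(N), whence by Axer's
   argument so is the sum of mu(d) {N/d} over them.
   M(N) = o(N) is proved by Selberg's method. His formula for the nonnegative
   convolution of mu and ln^2, which is Lambda ln plus the convolution square of
   Lambda, bounds |M(N)| ln^2 N by
     2 N sum_(j < N) |M(j)| / j^2 ln (N/j) + O(N ln N),
   so that limsup |M(N)|/N is at most a logarithmic mean of |M(j)|/j. That mean
   is strictly smaller than a positive limsup, because the sums
   sum_(a <= j < b) M(j) / (j (j+1)) are bounded, so M must be small somewhere
   in every long multiplicative block. *)
Require Import Defs.
From mathcomp Require Import all_boot all_order all_algebra finmap.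
From mathcomp Require Import all_classical all_reals all_analysis.
From mathcomp Require Import ring lra zify.
Set Implicit Arguments.
Unset Strict Implicit.
Unset Printing Implicit Defensive.
Import Order.TTheory GRing.Theory Num.Theory.
Import numFieldNormedType.Exports.
Local Open Scope ring_scope.

(** * Dirichlet convolution *)

Lemma big_nat1P (V : nmodType) (P : pred nat) (F : nat -> V) n :
  \sum_(n <= i < n.+1 | P i) F i = if P n then F n else 0.
Proof. by rewrite big_mkcond big_nat1. Qed.

Lemma sum_multiples (V : nmodType) (d N : nat) (F : nat -> V) : (0 < d)%N ->
  \sum_(1 <= n < N.+1 | (d %| n)%N) F n
  = \sum_(1 <= k < (N %/ d)%N.+1) F (k * d)%N.
Proof.
move=> d0; elim: N => [|N IH]; first by rewrite div0n !big_geq.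
rewrite big_mkcond big_nat_recr //= -big_mkcond IH divnS//.
case: ifP => dvd; rewrite /= ?addr0 // add1n [RHS]big_nat_recr//=.
have -> // : ((N %/ d).+1 * d)%N = N.+1.
by have := divnS N d0; rewrite dvd add1n => <-; rewrite divnK.
Qed.

(** Both sides run over the pairs [(d, k)] with [d * k <= N], through [n = d * k]. *)
Lemma sum_hyperbola (V : nmodType) (N : nat) (F : nat -> nat -> V) :
  \sum_(1 <= n < N.+1) \sum_(1 <= d < n.+1 | (d %| n)%N) F d (n %/ d)%N
  = \sum_(1 <= d < N.+1) \sum_(1 <= k < (N %/ d)%N.+1) F d k.
Proof.
transitivity (\sum_(1 <= n < N.+1) \sum_(1 <= d < N.+1)
    if (d %| n)%N then F d (n %/ d)%N else 0).
  apply: eq_big_nat => n /andP[n1 nN]; rewrite -[RHS]big_mkcond/=.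
  rewrite [LHS](big_nat_widen _ _ N.+1) //. apply: eq_bigl => d.
  by case dn: (d %| n)%N => //=; rewrite ltnS dvdn_leq//.
rewrite exchange_big_nat; apply: eq_big_nat => d /andP[d1 _].
rewrite -big_mkcond sum_multiples//; apply: eq_bigr => k _.
by rewrite mulnK.
Qed.

Lemma sum_hyperbolaC (V : nmodType) (N : nat) (F : nat -> nat -> V) :
  \sum_(1 <= d < N.+1) \sum_(1 <= k < (N %/ d)%N.+1) F d k
  = \sum_(1 <= k < N.+1) \sum_(1 <= d < (N %/ k)%N.+1) F d k.
Proof.
have widen (G : nat -> nat -> V) :
    \sum_(1 <= d < N.+1) \sum_(1 <= k < (N %/ d)%N.+1) G d k
    = \sum_(1 <= d < N.+1) \sum_(1 <= k < N.+1)
        if (d * k <= N)%N then G d k else 0.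
  apply: eq_big_nat => d /andP[d1 _]; rewrite -[RHS]big_mkcond/=.
  rewrite [LHS](big_nat_widen _ _ N.+1) ?ltnS ?leq_div//.
  apply: eq_bigl => k /=.
  by rewrite ltnS leq_divRL// mulnC.
rewrite widen exchange_big_nat (widen (fun k d => F d k)).
by apply: eq_bigr => k _; apply: eq_bigr => d _; rewrite mulnC.
Qed.

(** Convolution identities are proved on summatory functions, where commutativity and associativity
    become exchanges of double sums. *)
Lemma eq_summatory (V : zmodType) (f g : nat -> V) :
  f 0%N = g 0%N ->
  (forall N, \sum_(1 <= n < N.+1) f n = \sum_(1 <= n < N.+1) g n) -> f =1 g.
Proof.
move=> fg0 fg [//|n]; have := fg n.+1.
by rewrite big_nat_recr//= [in RHS]big_nat_recr//= fg => /addrI.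
Qed.

Section Convolution.
Context {R : realType}.
Implicit Types f g h : nat -> R.

Definition conv f g (n : nat) : R :=
  \sum_(1 <= d < n.+1 | (d %| n)%N) f d * g (n %/ d)%N.

Lemma conv0 f g : conv f g 0 = 0. Proof. by rewrite /conv big_geq. Qed.

Lemma sum_conv f g N : \sum_(1 <= n < N.+1) conv f g n
  = \sum_(1 <= d < N.+1) f d * \sum_(1 <= k < (N %/ d)%N.+1) g k.
Proof.
rewrite (sum_hyperbola N (fun d k => f d * g k)).
by apply: eq_bigr => d _; rewrite mulr_sumr.
Qed.

Lemma convC f g : conv f g =1 conv g f.
Proof.
apply: eq_summatory => [|N]; first by rewrite !conv0.
rewrite /conv (sum_hyperbola N (fun d k => f d * g k)) sum_hyperbolaC.
rewrite (sum_hyperbola N (fun d k => g d * f k)).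
by apply: eq_bigr => d _; apply: eq_bigr => k _; rewrite mulrC.
Qed.

Lemma sum_conv_weighted f g (w : nat -> R) N :
  \sum_(1 <= n < N.+1) conv f g n * w n
  = \sum_(1 <= d < N.+1) \sum_(1 <= k < (N %/ d)%N.+1) f d * g k * w (d * k)%N.
Proof.
rewrite -(sum_hyperbola N (fun d k => f d * g k * w (d * k)%N)).
apply: eq_big_nat => n _; rewrite mulr_suml; apply: eq_bigr => d dn.
by rewrite (mulnC d) divnK.
Qed.

Lemma convA f g h : conv f (conv g h) =1 conv (conv f g) h.
Proof.
apply: eq_summatory => [|N]; first by rewrite !conv0.
rewrite !sum_conv sum_conv_weighted; apply: eq_bigr => d _.
rewrite sum_conv mulr_sumr; apply: eq_bigr => k _.
by rewrite divnMA mulrA.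
Qed.

Lemma eq_conv f f' g g' n :
  (forall d, (0 < d)%N -> f d = f' d) -> (forall d, (0 < d)%N -> g d = g' d) ->
  conv f g n = conv f' g' n.
Proof.
move=> ff gg; rewrite /conv big_nat_cond [RHS]big_nat_cond.
apply: eq_bigr => d /andP[/andP[d1 dn] ddn].
by rewrite ff// gg// divn_gt0.
Qed.

Lemma convDr f g h n : conv f (fun m => g m + h m) n = conv f g n + conv f h n.
Proof. by rewrite /conv -big_split; apply: eq_bigr => d _; rewrite mulrDr. Qed.

Lemma convNr f g n : conv f (fun m => - g m) n = - conv f g n.
Proof. by rewrite /conv -sumrN; apply: eq_bigr => d _; rewrite mulrN. Qed.

Lemma conv_ge0 f g n : (forall m, 0 <= f m) -> (forall m, 0 <= g m) ->
  0 <= conv f g n.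
Proof. by move=> f0 g0; apply: sumr_ge0 => d _; apply: mulr_ge0. Qed.

Definition conv_unit (n : nat) : R := (n == 1%N)%:R.

Lemma conv_unitl f n : (0 < n)%N -> conv conv_unit f n = f n.
Proof.
move=> n0; rewrite /conv big_mkcond big_ltn//= dvd1n divn1 mul1r.
rewrite big_nat big1 ?addr0//= => d /andP[d1 _].
by rewrite /conv_unit gtn_eqF// mul0r; case: ifP.
Qed.

Lemma lnM_nat (a b : nat) : (0 < a)%N -> (0 < b)%N ->
  ln (a * b)%N%:R = ln a%:R + ln b%:R :> R.
Proof. by move=> a0 b0; rewrite natrM lnM// posrE ltr0n. Qed.

Definition lnmul f (n : nat) : R := ln n%:R * f n.

(** Since [ln] is additive on products, multiplication by it is a derivation of Dirichlet
    convolution. *)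
Lemma lnmul_conv f g n :
  lnmul (conv f g) n = conv (lnmul f) g n + conv f (lnmul g) n.
Proof.
rewrite /lnmul /conv mulr_sumr -big_split/= [LHS]big_nat_cond [RHS]big_nat_cond.
apply: eq_bigr => d /andP[/andP[d1 dn] ddn] /=.
rewrite -[in ln n%:R](divnK ddn) lnM_nat// ?divn_gt0//; ring.
Qed.

End Convolution.

(** * The Moebius and von Mangoldt functions *)

Lemma primes_mul_prime p k : prime p -> ~~ (p %| k)%N -> (0 < k)%N ->
  perm_eq (primes (p * k)) (p :: primes k).
Proof.
move=> pp pk k0; apply: uniq_perm; first exact: primes_uniq.
  by rewrite /= primes_uniq mem_primes (negbTE pk) !andbF.
by move=> q; rewrite primesM ?(prime_gt0 pp)// primes_prime// !inE.
Qed.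

Lemma moebius_mul_prime p k : prime p -> ~~ (p %| k)%N -> (0 < k)%N ->
  moebius (p * k) = - moebius k.
Proof.
move=> pp pk k0; have pr := primes_mul_prime pp pk k0.
rewrite /moebius (perm_all _ pr) (perm_size pr) /=.
have -> : (p ^ 2 %| p * k)%N = false.
  by rewrite dvdn_pmul2l ?prime_gt0//; exact/negbTE.
have -> : all (fun q => ~~ (q ^ 2 %| p * k)%N) (primes k)
    = all (fun q => ~~ (q ^ 2 %| k)%N) (primes k).
  apply: eq_in_all => q; rewrite mem_primes => /and3P[qp _ qk].
  rewrite Gauss_dvdr// coprimeXl// prime_coprime// dvdn_prime2//.
  by apply: contraNN pk => /eqP <-.
by rewrite /=; case: ifP => _; rewrite ?oppr0// exprS mulN1r.
Qed.

Lemma moebius_mul_dvd p k : prime p -> (p %| k)%N -> (0 < k)%N ->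
  moebius (p * k) = 0.
Proof.
move=> pp pk k0; rewrite /moebius; case: ifP => // /allP /(_ p).
rewrite mem_primes pp muln_gt0 prime_gt0// k0 dvdn_mulr// => /(_ isT).
by rewrite dvdn_pmul2l ?prime_gt0// pk.
Qed.

Section Mobius.
Context {R : realType}.
Implicit Types F : nat -> R.

(* [mu 0 = 0], unlike [moebius 0], so that identities between convolutions
   hold at every [n]. *)
Definition mu (n : nat) : R := if n is 0 then 0 else (moebius n)%:~R.
Arguments mu n : simpl never.

Lemma mu1 : mu 1 = 1. Proof. by []. Qed.

Lemma norm_mu_le1 n : `|mu n| <= 1.
Proof.
case: n => [|n]; rewrite /mu ?normr0 ?ler01//.
rewrite /moebius; case: ifP => _; last by rewrite normr0.
by rewrite rmorphXn/= rmorphN1 normrX normrN1 expr1n.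
Qed.

Lemma mu_mul_prime p k : prime p -> ~~ (p %| k)%N -> mu (p * k) = - mu k.
Proof.
case: k => [|k] pp pk; first by rewrite muln0 /mu oppr0.
have := moebius_mul_prime pp pk isT.
have : (0 < p * k.+1)%N by rewrite muln_gt0 prime_gt0.
by rewrite /mu; case: (p * k.+1)%N => //= m _ ->; rewrite rmorphN.
Qed.

Lemma mu_mul_dvd p k : prime p -> (p %| k)%N -> mu (p * k) = 0.
Proof.
case: k => [|k] pp pk; first by rewrite muln0.
have := moebius_mul_dvd pp pk isT.
have : (0 < p * k.+1)%N by rewrite muln_gt0 prime_gt0.
by rewrite /mu; case: (p * k.+1)%N => //= m _ ->.
Qed.

(* Only squarefree [d] contribute; those divisible by [p] are the [p * d] with
   [d] prime to [p], and [mu (p * d) = - mu d]. *)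
Lemma sum_mu_divisors_prime p n F : prime p -> (p %| n)%N ->
  \sum_(1 <= d < n.+1 | (d %| n)%N) mu d * F d
  = \sum_(1 <= d < n.+1 | (d %| n)%N && ~~ (p %| d)%N) mu d * (F d - F (p * d)%N).
Proof.
case: (posnP n) => [->|n0] pp pn; first by rewrite !big_geq.
rewrite (bigID (fun d => (p %| d)%N))/= addrC.
under [RHS]eq_bigr do rewrite mulrBr.
rewrite sumrB; congr (_ + _).
transitivity (\sum_(1 <= d < n.+1 | (p %| d)%N)
    if (d %| n)%N then mu d * F d else 0).
  by rewrite -big_mkcondr; apply: eq_bigl => d; rewrite andbC.
rewrite sum_multiples ?prime_gt0// -sumrN [RHS]big_mkcond/=.
have pn_le : ((n %/ p).+1 <= n.+1)%N by rewrite ltnS leq_div.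
rewrite [RHS](big_cat_nat _ pn_le)//= [X in _ = _ + X]big_nat.
rewrite [X in _ = _ + X]big1 ?addr0.
  apply: eq_bigr => k _; rewrite (mulnC k).
  case: (boolP (p %| k)%N) => pk.
    by rewrite mu_mul_dvd// mul0r andbF if_same.
  rewrite andbT Gauss_dvd ?prime_coprime// pn /=.
  by case: ifP => // _; rewrite mu_mul_prime// mulNr.
move=> d /andP[dn _]; case: ifP => // /andP[ddn pd].
move: dn; rewrite ltnNge leq_divRL ?prime_gt0// mulnC dvdn_leq//.
by rewrite Gauss_dvd ?prime_coprime// pn.
Qed.

(** For [n > 1], pair [d] with [p * d] for a prime [p] dividing [n]: constant weights make every
    pair cancel. *)
Lemma conv_mu_1 n : conv mu (fun=> 1) n = conv_unit n.
Proof.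
case: (leqP n 1) => [|n1].
  case: n => [|[|//]] _; first by rewrite conv0.
  by rewrite /conv big_nat1P dvd1n mulr1.
rewrite /conv (sum_mu_divisors_prime _ (pdiv_prime n1) (pdiv_dvd n)).
rewrite big1 => [|d _]; last by rewrite subrr mulr0.
by rewrite /conv_unit gtn_eqF.
Qed.

Definition vonMangoldt : nat -> R := conv mu (fun n => ln n%:R).

(** Pairing [d] with [p * d], [p] the least prime factor of [n], leaves [ln p] times a sum of [mu]
    over all divisors of an integer, which is 0 or 1. *)
Lemma vonMangoldt_ge0 n : 0 <= vonMangoldt n.
Proof.
case: (leqP n 1) => [|n1].
  case: n => [|[|//]] _; rewrite /vonMangoldt ?conv0//.
  by rewrite /conv big_nat1P dvd1n mul1r divn1 ln1.
have pp := pdiv_prime n1; have pn := pdiv_dvd n; set p := pdiv n in pp pn.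
have n0 : (0 < n)%N by apply: leq_trans n1.
rewrite /vonMangoldt /conv.
have -> : \sum_(1 <= d < n.+1 | (d %| n)%N) mu d * ln (n %/ d)%:R
  = \sum_(1 <= d < n.+1 | (d %| n)%N) mu d * (ln n%:R - ln d%:R).
  rewrite big_nat_cond [RHS]big_nat_cond.
  apply: eq_bigr => d /andP[/andP[d1 _] dn].
  by rewrite -[in RHS](divnK dn) lnM_nat ?divn_gt0 ?(dvdn_leq _ dn)// addrK.
rewrite (sum_mu_divisors_prime (fun d => ln n%:R - ln d%:R) pp pn).
have -> : \sum_(1 <= d < n.+1 | (d %| n)%N && ~~ (p %| d)%N)
    mu d * (ln n%:R - ln d%:R - (ln n%:R - ln (p * d)%:R))
  = ln p%:R * \sum_(1 <= d < n.+1 | (d %| n)%N && ~~ (p %| d)%N) mu d.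
  rewrite mulr_sumr big_nat_cond [RHS]big_nat_cond.
  apply: eq_bigr => d /andP[/andP[d1 _] _].
  by rewrite lnM_nat ?(prime_gt0 pp)//; ring.
apply: mulr_ge0; first by rewrite ln_ge0// ler1n prime_gt0.
(* The divisors of [n] prime to [p] are the divisors of its [p']-part. *)
have [m m_le dvdm] : exists2 m, (m <= n)%N
    & forall d, (d %| n)%N && ~~ (p %| d)%N = (d %| m)%N.
  exists (n`_p^')%N => [|d]; first by apply: dvdn_leq => //; exact: dvdn_part.
  apply/andP/idP => [[ddn pd]|dm].
    have : (d %| n`_p * n`_p^')%N by rewrite partnC.
    by rewrite p_part Gauss_dvdr// coprimeXr// coprime_sym prime_coprime.
  split; first exact: dvdn_trans dm (dvdn_part _ _).
  have : ~~ (p %| n`_p^')%N.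
    by rewrite -prime_coprime//; exact: pnat_coprime (pnat_id pp) (part_pnat _ _).
  by apply: contraNN => /dvdn_trans; apply.
have -> : \sum_(1 <= d < n.+1 | (d %| n)%N && ~~ (p %| d)%N) mu d
    = conv mu (fun=> 1) m.
  rewrite /conv [RHS](big_nat_widen _ _ n.+1)// [LHS]big_nat_cond [RHS]big_nat_cond.
  under [RHS]eq_bigr do rewrite mulr1.
  apply: eq_bigl => d /=; apply: andb_id2l => /andP[d1 dn].
  rewrite dvdm ltnS; case: (boolP (d %| m)%N) => // dm.
  (* [m = 0] is impossible: [p] would divide it, while [dvdm] excludes [p]. *)
  rewrite dvdn_leq//; case: m dvdm dm {m_le} => // dvdm _.
  by have := dvdm p; rewrite dvdnn andbF dvdn0.
by rewrite conv_mu_1 /conv_unit ler0n.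
Qed.

Lemma conv_1_vonMangoldt n : (0 < n)%N ->
  conv (fun=> 1) vonMangoldt n = ln n%:R.
Proof.
move=> n0; rewrite convA -[RHS](conv_unitl (fun n => ln n%:R))//.
by apply: eq_conv => // d d0; rewrite convC conv_mu_1.
Qed.

(** Written with two nonnegative summands, so that it dominates their difference in absolute value;
    [selberg_LambdaE] gives the form used for summation. *)
Definition selberg_Lambda (n : nat) : R :=
  lnmul vonMangoldt n + conv vonMangoldt vonMangoldt n.

Lemma lnmul_vonMangoldt_ge0 n : 0 <= lnmul vonMangoldt n.
Proof.
case: n => [|n]; first by rewrite /lnmul ln0// mul0r.
by rewrite mulr_ge0 ?vonMangoldt_ge0// ln_ge0// ler1n.
Qed.

(** Convolving with 1, the Leibniz rule and [1 * Lambda = ln] give [ln * Lambda + 1 * (Lambda ln) =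
    ln (1 * Lambda) = ln ^ 2]; convolution with [mu] inverts this. *)
Lemma selberg_LambdaE n : (0 < n)%N ->
  selberg_Lambda n = conv mu (fun m => ln m%:R ^+ 2) n.
Proof.
move=> n0; rewrite -[LHS]conv_unitl//.
transitivity (conv (conv mu (fun=> 1)) selberg_Lambda n).
  by apply: eq_conv => // d _; rewrite conv_mu_1.
rewrite -convA; apply: eq_conv => // d d0; rewrite convDr expr2.
rewrite convA -{1}conv_1_vonMangoldt// -/(lnmul _ _).
transitivity (lnmul (conv (fun=> 1) vonMangoldt) d); last first.
  by rewrite /lnmul mulrC.
rewrite lnmul_conv addrC; congr (_ + _); apply: eq_conv => // e e0.
by rewrite conv_1_vonMangoldt// /lnmul mulr1.
Qed.

(** The derivation [lnmul] kills the unit [mu * 1], so [(mu ln) * 1 = - mu * ln = - Lambda];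
    convolve with [mu]. *)
Lemma lnmul_mu n : (0 < n)%N -> lnmul mu n = - conv vonMangoldt mu n.
Proof.
move=> n0; apply/eqP; rewrite -addr_eq0; apply/eqP.
have lm d : conv (lnmul mu) (fun=> 1) d + vonMangoldt d = 0.
  have := lnmul_conv mu (fun=> 1) d; rewrite {1}/lnmul conv_mu_1 /conv_unit.
  have -> : ln d%:R * (d == 1%N)%:R = 0 :> R.
    by case: eqP => [->|_]; rewrite ?ln1 ?mul0r ?mulr0.
  move=> /esym; congr (_ + _ = _); apply: eq_conv => // e _.
  by rewrite /lnmul mulr1.
rewrite -[lnmul mu n](conv_unitl (lnmul mu))// convC.
have -> : conv (lnmul mu) conv_unit n = conv (conv (lnmul mu) (fun=> 1)) mu n.
  by rewrite -convA; apply: eq_conv => // d _; rewrite convC conv_mu_1.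
rewrite convC [conv vonMangoldt _ _]convC -convDr.
by rewrite /conv big1// => d _; rewrite lm mulr0.
Qed.

(** Apply [lnmul_mu] twice with the Leibniz rule. The two summands of [selberg_Lambda] occur here
    with opposite signs. *)
Lemma lnmul_lnmul_mu n : (0 < n)%N -> ln n%:R ^+ 2 * mu n =
  conv (fun k => conv vonMangoldt vonMangoldt k - lnmul vonMangoldt k) mu n.
Proof.
move=> n0; rewrite expr2 -mulrA -/(lnmul mu n) lnmul_mu// mulrN.
rewrite -/(lnmul _ n) lnmul_conv [RHS]convC convDr convNr.
rewrite opprD addrC; congr (_ - _); last by rewrite convC.
have -> : conv vonMangoldt (lnmul mu) n
    = conv vonMangoldt (fun m => - conv vonMangoldt mu m) n.
  by apply: eq_conv => // d d0; rewrite lnmul_mu.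
by rewrite convNr opprK convA convC.
Qed.

End Mobius.

Arguments mu {R} n : simpl never.

(** * Asymptotics of logarithmic sums *)

Section Asymptotics.
Context {R : realType}.
Implicit Types (x y : R) (s t : nat -> R).

(** The intervals with centre [s m] and radius [t m] are nested, hence share a point. This produces
    asymptotic constants together with explicit errors. *)
Lemma telescope_asymptotics s t :
  (forall k, (0 < k)%N -> 0 <= t k) ->
  (forall k, (0 < k)%N -> `|s k.+1 - s k| <= t k - t k.+1) ->
  exists l, forall m, (0 < m)%N -> `|s m - l| <= t m.
Proof.
move=> t0 st.
have inc m k : (0 < m)%N -> (m <= k)%N ->
    s m - t m <= s k - t k /\ s k + t k <= s m + t m.
  move=> m0; elim: k => [|k IH]; first by rewrite leqn0 => /eqP ->.
  rewrite leq_eqVlt => /predU1P[->//|]; rewrite ltnS => mk.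
  have [h1 h2] := IH mk; have := st k (leq_trans m0 mk).
  by rewrite ler_norml => /andP[h3 h4]; split; lra.
have lu m k : (0 < m)%N -> (0 < k)%N -> s m - t m <= s k + t k.
  move=> m0 k0; case: (leqP m k) => [mk|/ltnW km].
    by have [h _] := inc _ _ m0 mk; have := t0 k k0; lra.
  by have [_ h] := inc _ _ k0 km; have := t0 m m0; lra.
pose A : set R := [set z | exists2 m, (0 < m)%N & z = s m - t m]%classic.
have ubA k : (0 < k)%N -> ubound A (s k + t k).
  by move=> k0 z [m m0 ->]; exact: lu.
have A0 : (A !=set0)%classic by exists (s 1%N - t 1%N), 1%N.
exists (sup A) => m m0; rewrite ler_norml; apply/andP; split.
  by have := ge_sup A0 (ubA m m0); lra.
have : s m - t m <= sup A.
  apply: ub_le_sup; last by exists m.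
  by exists (s 1%N + t 1%N); exact: ubA.
by lra.
Qed.

Lemma ln_sub_le x y : 0 < x -> 0 < y -> ln x - ln y <= (x - y) / y.
Proof.
move=> x0 y0; rewrite -ln_div ?posrE//.
have -> : x / y = 1 + (x - y) / y by field; rewrite gt_eqF.
by apply: le_ln1Dx; rewrite mulrBl divff ?gt_eqF//; have := divr_gt0 x0 y0; lra.
Qed.

Lemma ln_succ_bounds k : (0 < k)%N ->
  k.+1%:R^-1 <= ln k.+1%:R - ln k%:R :> R /\ ln k.+1%:R - ln k%:R <= k%:R^-1 :> R.
Proof.
move=> k0; have k0' : 0 < k%:R :> R by rewrite ltr0n.
have k1 : 0 < k.+1%:R :> R by rewrite ltr0n.
have := ln_sub_le k1 k0'; have := ln_sub_le k0' k1.
have -> : (k%:R - k.+1%:R) / k.+1%:R = - k.+1%:R^-1 :> R.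
  by rewrite -natr1; field; rewrite natr1 gt_eqF.
have -> : (k.+1%:R - k%:R) / k%:R = k%:R^-1 :> R.
  by rewrite -natr1; field; rewrite gt_eqF.
move: (ln k.+1%:R) (ln k%:R) (k.+1%:R^-1) (k%:R^-1) => b a q p h1 h2; split; lra.
Qed.

Lemma ln_nat_ge0 n : 0 <= ln n%:R :> R.
Proof. by case: n => [|n]; [rewrite ln0|rewrite ln_ge0// ler1n]. Qed.

Lemma ler_ln_nat m n : (0 < m)%N -> (m <= n)%N -> ln m%:R <= ln n%:R :> R.
Proof.
by move=> m0 mn; rewrite ler_ln ?posrE ?ltr0n ?ler_nat//; exact: leq_trans mn.
Qed.

Lemma ln_le_subr1 x : 0 < x -> ln x <= x - 1.
Proof. by move=> x0; have := ln_sub_le x0 ltr01; rewrite ln1 divr1; lra. Qed.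

(** Apply [ln z <= z - 1] at the square root of [n]. *)
Lemma ln_sqr_le n : ln n%:R ^+ 2 <= 4 * n%:R :> R.
Proof.
case: n => [|n]; first by rewrite ln0// expr0n mulr0.
have n0 : 0 < n.+1%:R :> R by rewrite ltr0n.
have s0 : 0 < Num.sqrt n.+1%:R :> R by rewrite sqrtr_gt0.
have e : Num.sqrt n.+1%:R ^+ 2 = n.+1%:R :> R by rewrite sqr_sqrtr// ltW.
have : ln n.+1%:R <= 2 * Num.sqrt n.+1%:R :> R.
  by rewrite -[in leLHS]e lnXn// mulr2n; have := ln_le_subr1 s0; lra.
have := ln_nat_ge0 n.+1; rewrite -[in 4 * _]e; nra.
Qed.

Definition harmonic (n : nat) : R := \sum_(1 <= k < n.+1) k%:R^-1.

(** Here [gamma] is Euler's constant. *)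
Lemma harmonic_asymptotics : exists gamma : R, forall m, (0 < m)%N ->
  `|harmonic m - ln m%:R - gamma| <= m%:R^-1.
Proof.
apply: telescope_asymptotics => [k k0|k k0]; first by rewrite invr_ge0 ler0n.
have [h1 h2] := ln_succ_bounds k0.
rewrite /harmonic big_nat_recr//= ler_norml.
by move: (ln _) (ln _) (_^-1) (_^-1) h1 h2 => b a q p; lra.
Qed.

(** Polynomial relations between [1 / k] and [1 / (k + 1)] that bring later estimates within reach
    of [nra]. *)
Lemma inv_succ_bounds k : (0 < k)%N -> let p := k%:R^-1 : R in
  let q := k.+1%:R^-1 : R in [/\ 0 < q, p <= 1, p * q = p - q & p <= 2 * q].
Proof.
move=> k0 p q; have k1 : 1 <= k%:R :> R by rewrite ler1n.
have p0 : 0 < p by rewrite invr_gt0 ltr0n.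
have q0 : 0 < q by rewrite invr_gt0 ltr0n.
have p1 : p <= 1 by rewrite invf_le1 ?ltr0n.
have pq : p * q = p - q.
  by rewrite /p /q -natr1; field; rewrite natr1 !pnatr_eq0 -!lt0n k0.
by split => //; nra.
Qed.

Lemma sum_ln_div_asymptotics : exists gamma1 : R, forall m, (0 < m)%N ->
  `|\sum_(1 <= k < m.+1) ln k%:R / k%:R - ln m%:R ^+ 2 / 2 - gamma1|
  <= (3 + ln m%:R) / m%:R.
Proof.
apply: (@telescope_asymptotics
  (fun m => \sum_(1 <= k < m.+1) ln k%:R / k%:R - ln m%:R ^+ 2 / 2)
  (fun m => (3 + ln m%:R) / m%:R)) => [k k0|k k0].
  by rewrite divr_ge0 ?ler0n// addr_ge0 ?ln_nat_ge0.
have [] := ln_succ_bounds k0; have [] := inv_succ_bounds k0.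
have a0 := ln_nat_ge0 k; have b0 := ln_nat_ge0 k.+1.
rewrite big_nat_recr//= ler_norml.
set p := k%:R^-1; set q := k.+1%:R^-1; set b := ln k.+1%:R in b0 *.
set a := ln k%:R in a0 *; set S := \sum_(1 <= _ < _) _.
move=> q0 p1 pq p2q ql pu.
(* The increment to bound is [- b (b - a - q) + (b - a) ^ 2 / 2]. The 3 in the error term pays for
   [(b - a) p <= 2 (p - q)] and [(b - a) ^ 2 / 2 <= p - q]. *)
have h1 : p ^+ 2 <= 2 * (p - q) by nra.
have h2 : b * (b - a - q) <= b * (p - q) by nra.
have h3 : 0 <= b * (b - a - q) by nra.
have h4 : (b - a) ^+ 2 <= p ^+ 2 by nra.
have h5 : (b - a) * p <= p ^+ 2 by nra.
by apply/andP; split; nra.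
Qed.

(** The main term is the primitive of [ln ^ 2]. The error is not bounded, so it is carried through
    an induction. *)
Lemma sum_ln_sqr_asymptotics m : (0 < m)%N ->
  `|\sum_(1 <= k < m.+1) ln k%:R ^+ 2
    - m%:R * (ln m%:R ^+ 2 - 2 * ln m%:R + 2)|
  <= 2 * ln m%:R ^+ 2 + 3 * ln m%:R + 2 :> R.
Proof.
case: m => // m _; elim: m => [|k IH].
  by rewrite big_nat1 ln1 ler_norml; lra.
have k0 : (0 < k.+1)%N by [].
rewrite big_nat_recr//=; move: IH.
have [] := ln_succ_bounds k0; have [] := inv_succ_bounds k0.
have a0 := ln_nat_ge0 k.+1; have b0 := ln_nat_ge0 k.+2.
have x0 : 0 < k.+1%:R :> R by rewrite ltr0n.
have px : k.+1%:R * k.+1%:R^-1 = 1 :> R by rewrite divff ?gt_eqF.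
have qx : (k.+1%:R + 1) * k.+2%:R^-1 = 1 :> R by rewrite natr1 divff ?gt_eqF ?ltr0n.
have yx : k.+2%:R = k.+1%:R + 1 :> R by rewrite natr1.
rewrite !ler_norml; move: px qx yx.
move: (ln k.+1%:R) (ln k.+2%:R) (k.+1%:R^-1) (k.+2%:R^-1) a0 b0 => a b p q a0 b0.
move: (k.+1%:R) (k.+2%:R) x0 (\sum_(1 <= _ < _) _) => x y x0 S.
move=> px qx yx q0 p1 pq p2q ql pu /andP[IH1 IH2].
have u0 : 0 <= 1 - x * (b - a) by nra.
have u1 : 1 - x * (b - a) <= b - a by nra.
have h1 : (1 - x * (b - a)) * b <= (b - a) * b by nra.
have h2 : 0 <= (1 - x * (b - a)) * b by nra.
have h3 : 0 <= x * (b - a) ^+ 2 by rewrite mulr_ge0 ?sqr_ge0 ?ltW.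
have h4 : x * (b - a) ^+ 2 <= b - a by nra.
have h5 : 0 <= (b - a) * a by nra.
have e : b ^+ 2 - (y * (b ^+ 2 - 2 * b + 2) - x * (a ^+ 2 - 2 * a + 2))
  = 2 * ((1 - x * (b - a)) * b) - 2 * (1 - x * (b - a)) + x * (b - a) ^+ 2.
  by rewrite yx; ring.
by apply/andP; split; lra.
Qed.

End Asymptotics.

(** * Selberg's formula *)

Section Selberg.
Context {R : realType}.
Implicit Types (x y : R) (N m d : nat).

Lemma div_nat_bounds N d : (0 < d)%N ->
  (N %/ d)%:R <= N%:R / d%:R :> R /\ N%:R / d%:R <= (N %/ d)%:R + 1 :> R.
Proof.
move=> d0; have d0' : 0 < d%:R :> R by rewrite ltr0n.
rewrite ler_pdivlMr// ler_pdivrMr// natr1 -!natrM !ler_nat leq_divM.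
by rewrite ltnW// -ltn_divLR.
Qed.

(** Meant for [y = N / d] and [m = N %/ d]: estimates at integers pass to the real quotient. *)
Lemma ln_floor_bounds y m : (0 < m)%N -> m%:R <= y -> y <= m%:R + 1 ->
  0 <= ln y - ln m%:R <= m%:R^-1.
Proof.
move=> m0 my ym; have m0' : 0 < m%:R :> R by rewrite ltr0n.
have y0 : 0 < y by apply: lt_le_trans my.
have [_ hu] := @ln_succ_bounds R m m0.
rewrite subr_ge0 ler_ln ?posrE// my /=; apply: le_trans hu.
by rewrite lerB// ler_ln ?posrE ?ltr0n// -natr1.
Qed.

Lemma harmonic_floor_asymptotics : exists gamma : R, forall y m,
  (0 < m)%N -> m%:R <= y -> y <= m%:R + 1 ->
  `|harmonic m - ln y - gamma| <= 2 / m%:R.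
Proof.
have [gamma Hg] := @harmonic_asymptotics R; exists gamma => y m m0 my ym.
have := Hg m m0; have := ln_floor_bounds m0 my ym.
move: (harmonic m) (ln y) (ln m%:R) (m%:R^-1) => h l l' p.
by rewrite !ler_norml => /andP[h1 h2] /andP[h3 h4]; lra.
Qed.

Lemma sum_ln_sqr_approx : exists a b C : R, 0 <= C /\ forall y m,
  (0 < m)%N -> m%:R <= y -> y <= m%:R + 1 ->
  `|\sum_(1 <= k < m.+1) ln k%:R ^+ 2
    - \sum_(1 <= k < m.+1) (2 * (y / k%:R * ln (y / k%:R)) + a * (y / k%:R) + b)|
  <= C * (1 + ln y ^+ 2).
Proof.
have [g Hg] := @harmonic_asymptotics R.
have [g1 Hg1] := @sum_ln_div_asymptotics R.
(* With [l = ln y], the sum of [phi (y / k)] is [y (l ^ 2 + (2 g + a) l + a g + b - 2 g1)] up to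
   error; these values match [y (l ^ 2 - 2 l + 2)]. *)
pose a := - 2 - 2 * g; pose b := 2 + 2 * g1 - a * g.
exists a, b, (40 + 4 * `|a| + `|b|); split; first by rewrite !addr_ge0// mulr_ge0.
move=> y m m0 my ym.
have m0' : 0 < m%:R :> R by rewrite ltr0n.
have m1 : 1 <= m%:R :> R by rewrite ler1n.
have y0 : 0 < y by apply: lt_le_trans my.
have -> : \sum_(1 <= k < m.+1)
      (2 * (y / k%:R * ln (y / k%:R)) + a * (y / k%:R) + b)
    = 2 * y * ln y * harmonic m - 2 * y * (\sum_(1 <= k < m.+1) ln k%:R / k%:R)
      + a * y * harmonic m + b * m%:R.
  rewrite /harmonic !mulr_sumr -sumrB -big_split/=.
  have -> : b * m%:R = \sum_(1 <= k < m.+1) b by rewrite sumr_const_nat subn1 mulr_natr.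
  rewrite -big_split/=; apply: eq_big_nat => k /andP[k1 _].
  have k0 : 0 < k%:R :> R by rewrite ltr0n.
  by rewrite ln_div ?posrE//; ring.
have := Hg m m0; have := Hg1 m m0; have := @sum_ln_sqr_asymptotics R m m0.
have := ln_floor_bounds m0 my ym; have := @ln_nat_ge0 R m.
have pm : m%:R * m%:R^-1 = 1 :> R by rewrite divff ?gt_eqF.
have p0 : 0 < m%:R^-1 :> R by rewrite invr_gt0.
move: (harmonic m) (ln y) (ln m%:R) (m%:R^-1) pm p0 => H l l' p pm p0.
move: (\sum_(1 <= _ < _) _) (\sum_(1 <= _ < _) _) => L G.
move: (m%:R) my ym m0' m1 pm => {m m0 Hg Hg1} m my ym m0 m1 pm.
move=> l'0 /andP[t0 t1] hG hL hH.
pose h := H - l' - g; pose u := L - l' ^+ 2 / 2 - g1.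
pose v := G - m * (l' ^+ 2 - 2 * l' + 2); pose t := l - l'; pose r := y - m.
have yp : y * p <= 2 by nra.
have hv : `|v| <= 2 * l' ^+ 2 + 3 * l' + 2 by [].
have y0' := ltW y0.
have T1 : `|y * h| <= 2.
  by rewrite normrM ger0_norm//; apply: le_trans yp; exact: ler_wpM2l.
have T2 : `|y * u| <= 2 * (3 + l').
  rewrite normrM ger0_norm//. apply: le_trans (ler_wpM2l y0' hL) _.
  by rewrite mulrCA mulrC ler_wpM2r// addr_ge0.
have T3 : 0 <= y * t by apply: mulr_ge0.
have T3' : y * t <= 2 by apply: le_trans yp; exact: ler_wpM2l.
have t1' : t <= 1 by apply: le_trans t1 _; nra.
have l0 : 0 <= l by rewrite /t in t0; lra.
have r0 : 0 <= r by rewrite subr_ge0.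
have r1 : r <= 1 by rewrite /r; lra.
(* An exact identity: [h], [u], [v] are the errors of the three asymptotics, [t] and [r] those of
   replacing [m] by [y]. Each term is [O(1 + ln y ^ 2)]. *)
have -> : G - (2 * y * l * H - 2 * y * L + a * y * H + b * m) =
    - 2 * (y * t) * l + 2 * (y * t) * t + 2 * (y * t)
    - r * (l' ^+ 2 - 2 * l' + 2) + v - 2 * l * (y * h) + 2 * (y * u)
    - a * (y * h) + a * (y * t) + b * r.
  by rewrite /h /u /v /t /r /b /a; field.
have l'l : l' <= l by rewrite /t in t0; lra.
clearbody h u v t r a b.
have B1 : `|- 2 * (y * t) * l| <= 4 * l by rewrite ler_norml; nra.
have B2 : `|2 * (y * t) * t| <= 4 by rewrite ler_norml; nra.
have B3 : `|2 * (y * t)| <= 4 by rewrite ler_norml; lra.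
have ll : l' ^+ 2 <= l ^+ 2 by rewrite ler_sqr ?nnegrE.
have B4 : `|r * (l' ^+ 2 - 2 * l' + 2)| <= l ^+ 2 + 2.
  have h0 : 0 <= l' ^+ 2 - 2 * l' + 2 by nra.
  by rewrite ger0_norm ?mulr_ge0//; nra.
have B5 : `|v| <= 2 * l ^+ 2 + 3 * l + 2 by apply: le_trans hv _; lra.
have B6 : `|2 * l * (y * h)| <= 4 * l.
  by rewrite normrM ger0_norm ?mulr_ge0//; have := ler_wpM2l l0 T1; lra.
have B7 : `|2 * (y * u)| <= 12 + 4 * l by rewrite normrM ger0_norm//; lra.
have B8 : `|a * (y * h)| <= 2 * `|a|.
  by rewrite normrM mulrC ler_wpM2r.
have B9 : `|a * (y * t)| <= 2 * `|a|.
  by rewrite normrM mulrC ler_wpM2r// ger0_norm.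
have B10 : `|b * r| <= `|b|.
  by rewrite normrM ler_piMr// ger0_norm.
have A0 := normr_ge0 a; have A1 := normr_ge0 b.
have lsq : 2 * l <= 1 + l ^+ 2 by have := sqr_ge0 (l - 1); lra.
have N1 : 0 <= `|a| * l ^+ 2 by rewrite mulr_ge0 ?sqr_ge0.
have N2 : 0 <= `|b| * l ^+ 2 by rewrite mulr_ge0 ?sqr_ge0.
move: B1 B2 B3 B4 B5 B6 B7 B8 B9 B10 => {hv T1 T2 T3 T3'}.
move: (b * r) (a * (y * t)) (a * (y * h)) (2 * (y * u)) (2 * l * (y * h)) v
  (r * _) (2 * (y * t)) (2 * (y * t) * t) (- 2 * (y * t) * l).
move=> e10 e9 e8 e7 e6 e5 e4 e3 e2 e1.
move: {a b} `|a| `|b| (l ^+ 2) (sqr_ge0 l) A0 A1 lsq N1 N2 ll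
  => A B l2 l20 A0 B0 lsq N1 N2 ll.
rewrite !ler_norml => /andP[? ?] /andP[? ?] /andP[? ?] /andP[? ?] /andP[? ?].
move=> /andP[? ?] /andP[? ?] /andP[? ?] /andP[? ?] /andP[? ?].
by apply/andP; split; lra.
Qed.

Lemma sum_ln_nat_ge N : (0 < N)%N ->
  N%:R * ln N%:R - N%:R <= \sum_(1 <= k < N.+1) ln k%:R :> R.
Proof.
case: N => // N _; elim: N => [|N IH]; first by rewrite big_nat1 ln1; lra.
rewrite big_nat_recr//=; apply: le_trans (lerD IH (lexx _)).
have [_] := @ln_succ_bounds R N.+1 isT.
have x0 : 0 < N.+1%:R :> R by rewrite ltr0n.
have px : N.+1%:R * N.+1%:R^-1 = 1 :> R by rewrite divff ?gt_eqF.
have yx : N.+2%:R = N.+1%:R + 1 :> R by rewrite natr1.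
move: (ln N.+1%:R) (ln N.+2%:R) (N.+1%:R^-1) px => a b p px.
by move: (N.+1%:R) (N.+2%:R) x0 px yx => x y x0 px -> h; nra.
Qed.

Lemma sum_ln_quotient N : (0 < N)%N ->
  \sum_(1 <= d < N.+1) (ln N%:R - ln d%:R) <= N%:R :> R.
Proof.
move=> N0; rewrite sumrB sumr_const_nat subn1 -(mulr_natl (ln _) N).
by have := sum_ln_nat_ge N0; lra.
Qed.

(** On expanding the square, the terms of order [N ln N ^ 2] and [N ln N] cancel, and the error
    [O(ln N ^ 2)] is [O(N)]. *)
Lemma sum_ln_quotient_sqr : exists2 C : R, 0 <= C & forall N, (0 < N)%N ->
  \sum_(1 <= d < N.+1) (ln N%:R - ln d%:R) ^+ 2 <= C * N%:R.
Proof.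
exists 20 => // N N0.
have -> : \sum_(1 <= d < N.+1) (ln N%:R - ln d%:R) ^+ 2
   = N%:R * ln N%:R ^+ 2 - 2 * ln N%:R * \sum_(1 <= d < N.+1) ln d%:R
     + \sum_(1 <= d < N.+1) ln d%:R ^+ 2 :> R.
  have -> : N%:R * ln N%:R ^+ 2 = \sum_(1 <= d < N.+1) ln N%:R ^+ 2 :> R.
    by rewrite sumr_const_nat subn1 mulr_natl.
  rewrite mulr_sumr -sumrB -big_split/=; apply: eq_bigr => d _; ring.
have := sum_ln_nat_ge N0; have := @sum_ln_sqr_asymptotics R N N0.
have := @ln_sqr_le R N; have := @ln_nat_ge0 R N.
have : 1 <= N%:R :> R by rewrite ler1n.
move: (N%:R) (\sum_(1 <= _ < _) _) (\sum_(1 <= _ < _) _) => x G W.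
move: (ln x) => l x1 l0 lx; rewrite ler_norml => /andP[_ h1] h2.
have := ler_wpM2l l0 h2; nra.
Qed.

(** Group by [n = d * k]: since [mu * 1] is the unit, only [n = 1] survives. *)
Lemma mu_inversion (w : nat -> R) N : (0 < N)%N ->
  \sum_(1 <= d < N.+1) mu d * (\sum_(1 <= k < (N %/ d)%N.+1) w (d * k)%N) = w 1%N.
Proof.
move=> N0; have := sum_conv_weighted mu (fun=> 1) w N.
rewrite big_ltn//= conv_mu_1 mul1r big_nat big1 => [|n /andP[n1 _]]; last first.
  by rewrite conv_mu_1 /conv_unit gtn_eqF// mul0r.
rewrite addr0 => ->; apply: eq_bigr => d _; rewrite mulr_sumr.
by apply: eq_bigr => k _; rewrite mulr1.
Qed.

(* The summatory function of [mu * ln ^ 2] is [sum_d mu d * G (N / d)] with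
   [G] the summatory function of [ln ^ 2]. Choosing [a], [b] so that [G] is
   approximated by [k |-> sum_k phi (y / k)], [phi y = 2 y ln y + a y + b],
   Moebius inversion gives [phi N]. *)
Lemma selberg_formula : exists2 C : R, 0 <= C & forall N, (0 < N)%N ->
  `|\sum_(1 <= n < N.+1) selberg_Lambda n - 2 * (N%:R * ln N%:R)| <= C * N%:R.
Proof.
have [a [b [C [C0 HC]]]] := sum_ln_sqr_approx.
have [D D0 HD] := sum_ln_quotient_sqr.
exists (C * (1 + D) + `|a| + `|b|) => [|N N0].
  by rewrite !addr_ge0// mulr_ge0// addr_ge0.
have N0' : 0 < N%:R :> R by rewrite ltr0n.
have N1 : 1 <= N%:R :> R by rewrite ler1n.
pose phi (y : R) := 2 * (y * ln y) + a * y + b.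
have e1 : \sum_(1 <= n < N.+1) selberg_Lambda n
   = \sum_(1 <= d < N.+1) mu d * \sum_(1 <= k < (N %/ d)%N.+1) ln k%:R ^+ 2 :> R.
  rewrite -sum_conv; apply: eq_big_nat => n /andP[n1 _].
  exact: selberg_LambdaE.
have e2 : phi N%:R = \sum_(1 <= d < N.+1) mu d *
    \sum_(1 <= k < (N %/ d)%N.+1) phi (N%:R / d%:R / k%:R).
  rewrite -[in LHS](divr1 N%:R) -(@mu_inversion (fun n => phi (N%:R / n%:R)) N N0).
  apply: eq_bigr => d _; congr (_ * _); apply: eq_bigr => k _.
  by rewrite natrM invfM mulrA.
have : `|\sum_(1 <= n < N.+1) selberg_Lambda n - phi N%:R| <= C * (1 + D) * N%:R.
  rewrite e1 e2 -sumrB; apply: le_trans (ler_norm_sum _ _ _) _.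
  apply: (@le_trans _ _ (\sum_(1 <= d < N.+1) C * (1 + (ln N%:R - ln d%:R) ^+ 2))).
    apply: ler_sum_nat => d /andP[d1 dN].
    have d0' : 0 < d%:R :> R by rewrite ltr0n.
    rewrite -mulrBr normrM.
    apply: (@le_trans _ _ (1 * (C * (1 + ln (N%:R / d%:R) ^+ 2)))).
      apply: ler_pM => //; first exact: norm_mu_le1.
      by have [h1 h2] := div_nat_bounds N d1; apply: HC => //; rewrite divn_gt0.
    by rewrite mul1r ln_div ?posrE.
  rewrite -mulr_sumr -mulrA ler_wpM2l// big_split/= sumr_const_nat subn1 mulrDl mul1r.
  by rewrite lerD2l; exact: HD.
have ha : `|a * N%:R| = `|a| * N%:R by rewrite normrM (ger0_norm (ltW N0')).
have hb : `|b| <= `|b| * N%:R by rewrite ler_peMr.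
move: (ler_norm (a * N%:R)) (ler_norm (- (a * N%:R))) (ler_norm b) (ler_norm (- b)).
rewrite !normrN ha /phi !ler_norml => h1 h2 h3 h4 /andP[h5 h6].
by apply/andP; split; lra.
Qed.

Lemma selberg_formula_floor : exists2 C : R, 0 <= C & forall y m, (0 < m)%N ->
  m%:R <= y -> y <= m%:R + 1 ->
  `|\sum_(1 <= n < m.+1) selberg_Lambda n - 2 * (y * ln y)| <= C * y.
Proof.
have [C C0 HC] := selberg_formula; exists (C + 4) => [|y m m0 my ym].
  exact: addr_ge0.
have m0' : 0 < m%:R :> R by rewrite ltr0n.
have m1 : 1 <= m%:R :> R by rewrite ler1n.
have y0 : 0 < y by apply: lt_le_trans my.
have := HC m m0; have := ln_floor_bounds m0 my ym; have := @ln_nat_ge0 R m.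
have := ln_le_subr1 y0; have pm : m%:R * m%:R^-1 = 1 :> R by rewrite divff ?gt_eqF.
move: (\sum_(1 <= _ < _) _) (m%:R^-1) pm => S p pm.
move: (ln y) (ln m%:R) => l l'; move: (m%:R) my ym m0' m1 pm => x my ym x0 x1 pm.
move=> ly l'0 /andP[t0 t1]; rewrite !ler_norml => /andP[h1 h2].
have h3 : x * (l - l') <= 1 by nra.
have h3' : 0 <= x * (l - l') by nra.
have h4 : 0 <= (y - x) * l by nra.
have h5 : (y - x) * l <= l by nra.
have h6 : C * x <= C * y by nra.
by apply/andP; split; nra.
Qed.

End Selberg.

(** * The summatory function of the Moebius function *)

Lemma sum_by_parts (R : pzRingType) (a g : nat -> R) n : a 0%N = 0 ->
  \sum_(1 <= j < n.+2) (a j - a j.-1) * g j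
  = \sum_(1 <= j < n.+1) a j * (g j - g j.+1) + a n.+1 * g n.+1.
Proof.
move=> a0; elim: n => [|n IH]; first by rewrite big_nat1 big_geq// a0 subr0 add0r.
rewrite big_nat_recr//= IH [in RHS]big_nat_recr//= mulrBr mulrBl.
by rewrite [_ * g n.+2 - _]addrC -!addrA; congr (_ + _); rewrite !addrA subrK.
Qed.

Section Mertens.
Context {R : realType}.
Implicit Types (x y : R) (N m d k j : nat).

Definition mertens N : R := \sum_(1 <= n < N.+1) mu n.

Lemma mertens0 : mertens 0 = 0. Proof. by rewrite /mertens big_geq. Qed.

Lemma mertensS N : mertens N.+1 = mertens N + mu N.+1.
Proof. by rewrite /mertens big_nat_recr. Qed.

Lemma norm_mertens_le N : `|mertens N| <= N%:R.
Proof.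
apply: le_trans (ler_norm_sum _ _ _) _.
have -> : N%:R = \sum_(1 <= n < N.+1) 1 :> R by rewrite sumr_const_nat subn1.
by apply: ler_sum_nat => n _; exact: norm_mu_le1.
Qed.

Lemma norm_mertens_lip N k : `|mertens (N + k)| <= `|mertens N| + k%:R.
Proof.
elim: k => [|k IH]; first by rewrite addn0 addr0.
rewrite addnS mertensS -natr1 addrA; apply: le_trans (ler_normD _ _) _.
by rewrite lerD// norm_mu_le1.
Qed.

Lemma norm_norm_mertens_step j : (0 < j)%N ->
  `| `|mertens j| - `|mertens j.-1| | <= 1.
Proof.
case: j => // j _; apply: le_trans (ler_dist_dist _ _) _.
by rewrite mertensS addrC addKr norm_mu_le1.
Qed.

Lemma harmonic_le N : (0 < N)%N -> harmonic N <= 1 + ln N%:R :> R.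
Proof.
case: N => // N _; elim: N => [|N IH].
  by rewrite /harmonic big_nat1 ln1 invr1 addr0.
rewrite /harmonic big_nat_recr//=; have [+ _] := @ln_succ_bounds R N.+1 isT.
by move: IH; rewrite /harmonic; move: (_^-1) (\sum_(_ <= _ < _) _) => p S; lra.
Qed.


(** Replacing [ln N ^ 2] by [ln n ^ 2] inside the sum costs at most [2 ln N] times the sum of
    [ln (N / n)]. Then [lnmul_lnmul_mu] exhibits a convolution with [mu], and absolute values turn
    its other factor into [selberg_Lambda]. *)
Lemma mertens_ln_sqr_le N : (0 < N)%N ->
  `|mertens N| * ln N%:R ^+ 2 <=
  \sum_(1 <= k < N.+1) selberg_Lambda k * `|mertens (N %/ k)| + 2 * N%:R * ln N%:R.
Proof.
move=> N0; have L0 := @ln_nat_ge0 R N.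
have -> : `|mertens N| * ln N%:R ^+ 2 = `|mertens N * ln N%:R ^+ 2|.
  by rewrite normrM [X in _ = _ * X]ger0_norm// sqr_ge0.
have -> : mertens N * ln N%:R ^+ 2
   = \sum_(1 <= n < N.+1) ln n%:R ^+ 2 * mu n
     + \sum_(1 <= n < N.+1) mu n * (ln N%:R ^+ 2 - ln n%:R ^+ 2).
  by rewrite -big_split mulr_suml; apply: eq_bigr => n _ /=; ring.
apply: le_trans (ler_normD _ _) _; apply: lerD.
  rewrite (_ : \sum_(1 <= n < N.+1) _ = \sum_(1 <= n < N.+1) conv (fun k =>
      conv vonMangoldt vonMangoldt k - lnmul vonMangoldt k) mu n); last first.
    by apply: eq_big_nat => n /andP[n1 _]; exact: lnmul_lnmul_mu.
  rewrite sum_conv; apply: le_trans (ler_norm_sum _ _ _) _.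
  apply: ler_sum => k _; rewrite normrM ler_wpM2r// /selberg_Lambda [leRHS]addrC.
  apply: le_trans (ler_normB _ _) _.
  rewrite !ger0_norm ?lnmul_vonMangoldt_ge0//.
  by apply: conv_ge0 => m; exact: vonMangoldt_ge0.
apply: le_trans (ler_norm_sum _ _ _) _.
apply: (@le_trans _ _ (\sum_(1 <= n < N.+1) 2 * ln N%:R * (ln N%:R - ln n%:R))).
  apply: ler_sum_nat => n /andP[n1 nN].
  have h1 := @ln_nat_ge0 R n; have h2 := @ler_ln_nat R _ _ n1 nN.
  rewrite normrM -[leRHS]mul1r; apply: ler_pM => //; first exact: norm_mu_le1.
  by rewrite ger0_norm; nra.
rewrite -mulr_sumr [leRHS]mulrAC ler_wpM2l ?mulr_ge0//.
exact: sum_ln_quotient.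
Qed.

(** Write [|M(N %/ k)|] as the sum of its increments over [j <= N %/ k], exchange the sums and
    insert Selberg's formula at [N / j]. The increments are at most 1 in size, so the errors
    [C N / j] add up harmonically. *)
Lemma sum_selberg_mertens : exists2 C : R, 0 <= C & forall N, (0 < N)%N ->
  \sum_(1 <= k < N.+1) selberg_Lambda k * `|mertens (N %/ k)| <=
  2 * N%:R * \sum_(1 <= j < N.+1)
    (`|mertens j| - `|mertens j.-1|) * ((ln N%:R - ln j%:R) / j%:R)
  + C * N%:R * (1 + ln N%:R).
Proof.
have [C C0 HC] := @selberg_formula_floor R; exists C => // N N0.
have N0' : 0 < N%:R :> R by rewrite ltr0n.
have -> : \sum_(1 <= k < N.+1) selberg_Lambda k * `|mertens (N %/ k)| =
  \sum_(1 <= j < N.+1) (`|mertens j| - `|mertens j.-1|) *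
    \sum_(1 <= k < (N %/ j)%N.+1) selberg_Lambda k.
  transitivity (\sum_(1 <= k < N.+1) \sum_(1 <= j < (N %/ k)%N.+1)
      selberg_Lambda k * (`|mertens j| - `|mertens j.-1|)).
    apply: eq_bigr => k _; rewrite -mulr_sumr; congr (_ * _).
    by rewrite big_add1 telescope_sumr//= mertens0 normr0 subr0.
  rewrite sum_hyperbolaC; apply: eq_bigr => j _; rewrite mulr_sumr.
  by apply: eq_bigr => k _; rewrite mulrC.
apply: (@le_trans _ _ (\sum_(1 <= j < N.+1)
  (2 * N%:R * ((`|mertens j| - `|mertens j.-1|) * ((ln N%:R - ln j%:R) / j%:R))
   + C * N%:R * j%:R^-1))); last first.
  rewrite big_split/= -!mulr_sumr lerD2l ler_wpM2l ?mulr_ge0 ?ler0n//.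
  exact: harmonic_le.
apply: ler_sum_nat => j /andP[j1 jN].
have j0 : 0 < j%:R :> R by rewrite ltr0n.
have [h1 h2] := @div_nat_bounds R N j j1.
have := HC _ _ _ h1 h2; rewrite divn_gt0// => /(_ jN).
have := norm_norm_mertens_step j1; rewrite ln_div ?posrE//.
move: (_ - _) (\sum_(_ <= _ < _) _) (ln _ - ln _) => b S l.
have -> : 2 * N%:R * (b * (l / j%:R)) = b * (2 * (N%:R / j%:R * l)) by ring.
rewrite -[C * _ / _]mulrA; move: (2 * _) (C * _) => s c b1 Ss.
rewrite -lerBlDl -mulrBr; apply: le_trans (ler_norm _) _.
by rewrite normrM -[leRHS]mul1r ler_pM.
Qed.

(** Summation by parts returns from the increments of [|M|] to [|M(j)|], the boundary term at
    [j = N] being zero. The differences of [(ln N - ln j) / j] are at most [(ln N - ln j) / j ^ 2]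
    up to terms that sum to [O(1 + ln N)]. *)
Lemma mertens_inequality : exists2 C : R, 0 <= C & forall N, (0 < N)%N ->
  `|mertens N| * ln N%:R ^+ 2 <= N%:R *
  (2 * (\sum_(1 <= j < N) `|mertens j| / j%:R ^+ 2 * (ln N%:R - ln j%:R))
   + C * (1 + ln N%:R)).
Proof.
have [C C0 HC] := sum_selberg_mertens; exists (C + 4) => [|N N0].
  exact: addr_ge0.
have N0' : 0 <= N%:R :> R by rewrite ler0n.
have L0 := @ln_nat_ge0 R N.
apply: le_trans (mertens_ln_sqr_le N0) _.
apply: (le_trans (lerD (HC N N0) (lexx _))).
suff h : \sum_(1 <= j < N.+1)
    (`|mertens j| - `|mertens j.-1|) * ((ln N%:R - ln j%:R) / j%:R) <=
    \sum_(1 <= j < N) `|mertens j| / j%:R ^+ 2 * (ln N%:R - ln j%:R)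
    + (1 + ln N%:R).
  move: h; move: (\sum_(1 <= j < N) _) (\sum_(1 <= j < N.+1) _) => S T h.
  have := ler_wpM2l N0' h.
  by have := mulr_ge0 N0' L0; nra.
rewrite -{1}(prednK N0) (@sum_by_parts _ (fun j => `|mertens j|)) ?mertens0 ?normr0//.
rewrite (prednK N0) subrr mul0r mulr0 addr0.
apply: le_trans (lerD (lexx _) (harmonic_le N0)).
apply: (@le_trans _ _ (\sum_(1 <= j < N)
  (`|mertens j| / j%:R ^+ 2 * (ln N%:R - ln j%:R) + j%:R^-1))); last first.
  rewrite big_split/= lerD2l /harmonic [leRHS]big_nat_recr//=.
  by rewrite lerDl invr_ge0.
apply: ler_sum_nat => j /andP[j1 jN].
have [] := @ln_succ_bounds R j j1; have [] := @inv_succ_bounds R j j1.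
have := @ler_ln_nat R _ _ j1 (ltnW jN); have := norm_mertens_le j.
have pj : j%:R^-1 * j%:R = 1 :> R by rewrite mulVf// pnatr_eq0 -lt0n.
have p0 : 0 < j%:R^-1 :> R by rewrite invr_gt0 ltr0n.
rewrite -exprVn; have m0 := normr_ge0 (mertens j); move: pj p0 m0.
move: (`|mertens j|) (ln N%:R) (ln j%:R) (ln j.+1%:R) => m L a b.
move: (j.+1%:R^-1) (j%:R^-1) => q p; move: (j%:R) => x.
move=> pj p0 m0 mx aL q0 p1 pq p2q ql pu.
have e : m * ((L - a) * p - (L - b) * q)
   = m * (L - a) * (p - q) + m * ((b - a) * q) by ring.
have h0 : 0 <= m * (L - a) by rewrite mulr_ge0// subr_ge0.
have h1 : m * (L - a) * (p - q) <= m * (L - a) * p ^+ 2.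
  by rewrite ler_wpM2l//; nra.
have h2 : (b - a) * q <= p ^+ 2 by nra.
have h3 : m * p ^+ 2 <= p by nra.
have := ler_wpM2l m0 h2; lra.
Qed.

End Mertens.

(** * The bound M(N) = o(N) by repeated lowering of an eventual bound on |M(N)|/N *)

Section MertensLittleO.
Context {R : realType}.
Implicit Types (x y c beta : R) (N m k j a b : nat) (T : nat -> R).

Lemma ln_nat_large x : exists N0, forall N, (N0 <= N)%N -> x <= ln N%:R.
Proof.
exists (Num.truncn (expR x)).+1 => N hN.
have h : expR x < N%:R.
  by apply: lt_le_trans (truncnS_gt _) _; rewrite ler_nat.
have N0' : 0 < N%:R :> R by apply: lt_trans h; exact: expR_gt0.
by rewrite -[leLHS]expRK ler_ln ?posrE ?expR_gt0// ltW.
Qed.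

Lemma nat_large x : exists N0, forall N, (N0 <= N)%N -> x <= N%:R.
Proof.
exists (Num.truncn x).+1 => N hN; apply: (@le_trans _ _ (Num.truncn x).+1%:R).
  exact: ltW (truncnS_gt _).
by rewrite ler_nat.
Qed.

(** Since the sum of [mu n * (N %/ n)] is 1, [N] times the sum differs by 1 from a sum of [mu n]
    times fractional parts, hence is at most [N + 1]. *)
Lemma norm_sum_mu_div_le N : `|\sum_(1 <= n < N.+1) mu n / n%:R| <= 2 :> R.
Proof.
case: (posnP N) => [->|N0]; first by rewrite big_geq// normr0.
have N0' : 0 < N%:R :> R by rewrite ltr0n.
rewrite -(ler_pM2l N0') -[X in X * `|_| <= _](ger0_norm (ltW N0')) -normrM.
have -> : N%:R * (\sum_(1 <= n < N.+1) mu n / n%:R)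
  = \sum_(1 <= n < N.+1) mu n * (N%:R / n%:R - (N %/ n)%:R) + 1 :> R.
  rewrite -[X in _ + X](@mu_inversion R (fun=> 1) N N0) -big_split/= mulr_sumr.
  by apply: eq_bigr => n _; rewrite sumr_const_nat subn1 /=; ring.
apply: le_trans (ler_normD _ _) _; rewrite normr1.
have : `|\sum_(1 <= n < N.+1) mu n * (N%:R / n%:R - (N %/ n)%:R)| <= N%:R :> R.
  have {2}-> : N%:R = \sum_(1 <= n < N.+1) 1 :> R by rewrite sumr_const_nat subn1.
  apply: le_trans (ler_norm_sum _ _ _) _; apply: ler_sum_nat => n /andP[n1 _].
  have [h1 h2] := @div_nat_bounds R N n n1.
  rewrite normrM -[leRHS]mulr1 ler_pM ?norm_mu_le1//.
  by rewrite ger0_norm ?subr_ge0// lerBlDl.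
have : 1 <= N%:R :> R by rewrite ler1n.
by move=> h1 h2; apply: le_trans (lerD h2 (lexx 1)) _; lra.
Qed.

(** By parts, a sum starting at 1 is a partial sum of [mu n / n] minus a value of [M(n) / n], hence
    at most 3; a block is a difference of two such sums. *)
Lemma norm_sum_mertens_le a b : (0 < a)%N -> (a <= b)%N ->
  `|\sum_(a <= m < b) mertens m * (m%:R^-1 - m.+1%:R^-1)| <= 6 :> R.
Proof.
have H n : (0 < n)%N ->
    `|\sum_(1 <= m < n) mertens m * (m%:R^-1 - m.+1%:R^-1)| <= 3 :> R.
  case: n => // n _; have := @sum_by_parts R mertens (fun j => j%:R^-1) n mertens0.
  move/eqP; rewrite -subr_eq => /eqP <-.
  apply: le_trans (ler_normB _ _) _.
  have h1 : `|\sum_(1 <= j < n.+2) (mertens j - mertens j.-1) * j%:R^-1| <= 2 :> R.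
    rewrite (_ : \sum_(1 <= j < n.+2) _ = \sum_(1 <= j < n.+2) mu j / j%:R).
      exact: norm_sum_mu_div_le.
    apply: eq_big_nat => -[//|j] _.
    by rewrite mertensS [mertens j + _]addrC addrK.
  have h2 : `|mertens n.+1 / n.+1%:R| <= 1 :> R.
    by rewrite normrM normfV normr_nat ler_pdivrMr ?ltr0n// mul1r norm_mertens_le.
  by apply: le_trans (lerD h1 h2) _; lra.
move=> a0 ab; have := H a a0; have := H b (leq_trans a0 ab).
rewrite (big_cat_nat a0 ab)/=; move: (\sum_(1 <= _ < a) _) (\sum_(a <= _ < b) _).
by move=> u v; rewrite !ler_norml => /andP[? ?] /andP[? ?]; lra.
Qed.

Lemma sum_inv_ge a b : (0 < a)%N -> (a <= b)%N ->
  ln b%:R - ln a%:R <= \sum_(a <= m < b) m%:R^-1 :> R.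
Proof.
move=> a0 ab; rewrite -(@telescope_sumr R a b (fun m => ln m%:R))//.
apply: ler_sum_nat => m /andP[am _].
by have [] := @ln_succ_bounds R m (leq_trans a0 am).
Qed.

(* On a long block without small values [mertens] keeps a constant sign, and
   its weighted sum over the block is both large and bounded. *)
Lemma small_mertens c : 0 < c -> exists2 K, (0 < K)%N &
  forall a, (0 < a)%N -> 1 <= c * a%:R ->
  exists2 m, (a <= m < K * a)%N & `|mertens m| <= c * m%:R.
Proof.
move=> c0; have [K0 HK] := ln_nat_large (12 / c + 1).
exists K0.+1 => // a a0 ca; apply: contrapT => Hn.
set K := K0.+1 in Hn; have {HK} lK : 12 / c + 1 <= ln K%:R by apply: HK.
have aK : (a <= K * a)%N by rewrite leq_pmull.
have {}Hn m : (a <= m < K * a)%N -> c * m%:R < `|mertens m|.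
  by move=> h; rewrite ltNge; apply/negP => h'; apply: Hn; exists m.
pose s : R := Num.sg (mertens a).
(* Steps of size at most 1 cannot change the sign while the absolute value exceeds 1. *)
have sM m : (a <= m < K * a)%N -> s * mertens m = `|mertens m|.
  elim: m => [|m IH] /andP[am mK]; first by rewrite leqNgt a0 in am.
  move: am; rewrite leq_eqVlt => /predU1P[<-|]; first by rewrite normrEsg.
  rewrite ltnS => am; have mK' := ltnW mK.
  have {}IH : s * mertens m = `|mertens m| by apply: IH; rewrite am.
  have h : 1 < `|mertens m| :> R.
    have hm : (a <= m < K * a)%N by rewrite am.
    apply: le_lt_trans (Hn m hm).
    by apply: le_trans ca _; rewrite ler_pM2l// ler_nat.
  have s1 : `|s| = 1.
    by rewrite normr_sg; case: eqP h => // e; rewrite -IH /s e sgr0 mul0r ltr10.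
  have : 0 < s * mertens m.+1.
    rewrite mertensS mulrDr IH.
    have : `|s * mu m.+1| <= 1 by rewrite normrM s1 mul1r norm_mu_le1.
    by rewrite ler_norml => /andP[? ?]; lra.
  by move=> h'; rewrite -[LHS]ger0_norm ?ltW// normrM s1 mul1r.
have up : \sum_(a <= m < K * a) `|mertens m| * (m%:R^-1 - m.+1%:R^-1) <= 6 :> R.
  have s1 : `|s| <= 1 by rewrite normr_sg; case: eqP => _ //; rewrite ler01.
  rewrite (_ : \sum_(a <= m < K * a) _
    = s * \sum_(a <= m < K * a) mertens m * (m%:R^-1 - m.+1%:R^-1)); last first.
    by rewrite mulr_sumr; apply: eq_big_nat => m h; rewrite -sM// mulrA.
  apply: le_trans (ler_norm _) _; rewrite normrM -[leRHS]mul1r.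
  by rewrite ler_pM// norm_sum_mertens_le.
have dn : c / 2 * \sum_(a <= m < K * a) m%:R^-1
    <= \sum_(a <= m < K * a) `|mertens m| * (m%:R^-1 - m.+1%:R^-1).
  rewrite mulr_sumr; apply: ler_sum_nat => m h.
  have m0 : (0 < m)%N by case/andP: h => h _; exact: leq_trans h.
  have := Hn m h; have [] := @inv_succ_bounds R m m0.
  have pj : m%:R^-1 * m%:R = 1 :> R by rewrite mulVf// pnatr_eq0 -lt0n.
  have : 0 < m%:R^-1 :> R by rewrite invr_gt0 ltr0n.
  move: (`|_|) (_^-1) (_^-1) pj => t q p; move: (m%:R) => x pj p0 q0 p1 pq p2q tx.
  have pq0 : 0 <= p - q by rewrite -pq mulr_ge0 ?ltW.
  have h1 : c * x * (p - q) <= t * (p - q) by rewrite ler_wpM2r// ltW.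
  have h2 : c * x * (p - q) = c * q * (p * x) by rewrite -pq; ring.
  by rewrite h2 pj mulr1 in h1; have := ler_wpM2l (ltW c0) p2q; lra.
have := sum_inv_ge a0 aK; rewrite lnM_nat//.
have : c / 2 * (12 / c + 1) = 6 + c / 2 by field; rewrite gt_eqF.
move: up dn; move: (\sum_(_ <= _ < _) _) (\sum_(_ <= _ < _) _) => S T up dn e h.
by have : c / 2 * (12 / c + 1) <= c / 2 * S; [rewrite ler_wpM2l//; lra|lra].
Qed.

(** Around [m1] with [|M(m1)| <= c m1], the Lipschitz bound keeps [|M(m)| <= 2 c m] for [k] further
    integers, [k] the integer part of [c m1]. Each saves at least [c / m1], and [k >= c m1 / 2]. The
    factor 2 in [2 * K] leaves room for this stretch, as [k <= m1]. *)
Lemma block_saving c : 0 < c -> c <= 1 -> exists2 q, (1 < q)%N &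
  forall beta a, 4 * c <= beta -> 2 <= c * a%:R ->
  (forall m, (a <= m)%N -> `|mertens m| <= beta * m%:R) ->
  c ^+ 2 / 2 <= \sum_(a <= m < q * a) (beta / m%:R - `|mertens m| / m%:R ^+ 2).
Proof.
move=> c0 c1; have [K K0 HK] := small_mertens c0.
exists (2 * K)%N => [|beta a cb ca Mb]; first by rewrite mul2n -addnn -addn1 leq_add.
have a0 : (0 < a)%N by rewrite lt0n; apply/eqP => e; move: ca; rewrite e mulr0; lra.
have ca1 : 1 <= c * a%:R by lra.
have [m1 /andP[am mK] Mm] := HK a a0 ca1.
have m10 : (0 < m1)%N by apply: leq_trans am.
have x0 : 0 < m1%:R :> R by rewrite ltr0n.
pose k := Num.truncn (c * m1%:R).
have cm0 : 0 <= c * m1%:R by rewrite mulr_ge0 ?ltW.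
have kle : k%:R <= c * m1%:R by rewrite truncn_le.
have kgt : c * m1%:R < k%:R + 1 by rewrite natr1 truncnS_gt.
have km : (k <= m1)%N by rewrite -(ler_nat R); nra.
have h_ge0 m : (a <= m)%N -> 0 <= beta / m%:R - `|mertens m| / m%:R ^+ 2.
  move=> h; have m0 : 0 < m%:R :> R by rewrite ltr0n (leq_trans a0).
  rewrite subr_ge0 ler_pdivrMr ?exprn_gt0// expr2 mulrA divfK ?gt_eqF//.
  exact: Mb.
have kb : (m1 + k <= 2 * K * a)%N.
  rewrite -mulnA mul2n -addnn; apply: leq_add; first exact: ltnW.
  exact: leq_trans km (ltnW mK).
rewrite (big_cat_nat am)/=; last by rewrite (leq_trans _ kb)// leq_addr.
rewrite (big_cat_nat (leq_addr k m1) kb)/=.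
have S1 : 0 <= \sum_(a <= m < m1) (beta / m%:R - `|mertens m| / m%:R ^+ 2).
  by rewrite big_nat; apply: sumr_ge0 => m /andP[h _]; exact: h_ge0.
have S3 : 0 <= \sum_(m1 + k <= m < 2 * K * a)
    (beta / m%:R - `|mertens m| / m%:R ^+ 2).
  rewrite big_nat; apply: sumr_ge0 => m /andP[h _]; apply: h_ge0.
  by rewrite (leq_trans am)// (leq_trans _ h)// leq_addr.
have S2 : \sum_(m1 <= m < m1 + k) c / m1%:R <=
    \sum_(m1 <= m < m1 + k) (beta / m%:R - `|mertens m| / m%:R ^+ 2).
  apply: ler_sum_nat => m /andP[h1 h2].
  have m0 : 0 < m%:R :> R by rewrite ltr0n (leq_trans m10).
  have xm : m1%:R <= m%:R :> R by rewrite ler_nat.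
  have mx : m%:R <= 2 * m1%:R :> R.
    by rewrite -natrM ler_nat mul2n -addnn (leq_trans (ltnW h2))// leq_add2l.
  have Mm2 : `|mertens m| <= 2 * c * m%:R.
    rewrite -(subnKC h1); apply: le_trans (norm_mertens_lip _ _) _.
    rewrite (subnKC h1).
    have : (m - m1)%:R <= k%:R :> R by rewrite ler_nat leq_subLR ltnW.
    by nra.
  rewrite ler_pdivrMr// mulrBl lerBrDr.
  apply: le_trans (_ : c + 2 * c * (m1%:R / m%:R) <= _).
    rewrite lerD2l mulrAC ler_pdivrMr ?exprn_gt0//.
    have -> : 2 * c * (m1%:R / m%:R) * m%:R ^+ 2 = 2 * c * m%:R * m1%:R.
      by field; rewrite gt_eqF.
    by rewrite ler_pM2r.
  have r2 : 1 <= 2 * (m1%:R / m%:R) :> R by rewrite mulrA ler_pdivlMr// mul1r.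
  rewrite mulrAC -mulrA; have := ler_wpM2r (_ : 0 <= m1%:R / m%:R :> R) cb.
  by move=> /(_ (divr_ge0 (ltW x0) (ltW m0))); nra.
move: S2; rewrite sumr_const_nat addKn -mulr_natl => S2.
have : c ^+ 2 / 2 <= k%:R * (c / m1%:R).
  rewrite mulrA ler_pdivlMr//.
  have h : c * a%:R <= c * m1%:R by rewrite ler_pM2l// ler_nat.
  have h1 : c * m1%:R / 2 <= k%:R by lra.
  by have := ler_wpM2r (ltW c0) h1; lra.
by lra.
Qed.

(** A loss of [eta] at each multiplication by [q] is a loss proportional to [ln n]; the 2 in [2 * q]
    absorbs the rounding in [n %/ q]. *)
Lemma log_decay T q a0 (eta : R) : (1 < q)%N -> (0 < a0)%N -> 0 < eta ->
  (forall n m, (a0 <= n)%N -> (n <= m)%N -> T m <= T n) ->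
  (forall a, (a0 <= a)%N -> T (q * a)%N <= T a - eta) ->
  exists C, forall n, (0 < n)%N ->
    T n <= C - eta / (1 + ln (2 * q)%:R) * ln n%:R.
Proof.
move=> q1 a00 eta0 Tn Tq; have q0 : (0 < q)%N by apply: ltnW.
have L0 := @ln_nat_ge0 R (2 * q).
pose kappa := eta / (1 + ln (2 * q)%:R).
have k0 : 0 <= kappa by apply: divr_ge0; [exact: ltW|exact: addr_ge0].
have keta : kappa * ln (2 * q)%:R <= eta.
  by rewrite /kappa mulrAC ler_pdivrMr; [rewrite ler_pM2l//|]; lra.
(* The constant covers all [n < q * a0], where the induction starts. *)
exists (\sum_(0 <= j < q * a0) `|T j| + kappa * ln (q * a0)%:R).
rewrite -/kappa; elim/ltn_ind => n IH n0; case: (ltnP n (q * a0)) => [nq|qn].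
  have h1 : T n <= \sum_(0 <= j < q * a0) `|T j|.
    rewrite (big_cat_nat (leq0n n) (ltnW nq))/= [X in _ + X]big_ltn//.
    have : 0 <= \sum_(0 <= i < n) `|T i| by rewrite sumr_ge0.
    have : 0 <= \sum_(n.+1 <= i < q * a0) `|T i| by rewrite sumr_ge0.
    by have := ler_norm (T n); lra.
  have h2 := @ler_ln_nat R _ _ n0 (ltnW nq).
  by have := ler_wpM2l k0 h2; lra.
pose a := (n %/ q)%N.
have aa : (a0 <= a)%N by rewrite leq_divRL// mulnC.
have a_gt0 : (0 < a)%N by apply: leq_trans aa.
have an : (a < n)%N by rewrite ltn_Pdiv.
have qan : (q * a <= n)%N by rewrite mulnC leq_divM.
have h1 : T n <= T a - eta.
  apply: le_trans (Tq a aa); apply: Tn => //; apply: leq_trans aa _.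
  by rewrite leq_pmull.
have h2 : ln n%:R <= ln (2 * q)%:R + ln a%:R :> R.
  rewrite -lnM_nat ?muln_gt0//; apply: ler_ln_nat => //.
  by have := ltn_ceil n q0; rewrite -/a; nia.
have := IH a an a_gt0; have := ler_wpM2l k0 h2; lra.
Qed.

(** The saving on every block gives [sum |M(j)| / j ^ 2 <= (beta - kappa) ln n + O(1)]; by parts,
    the weight [ln (N / j)] gives half of [(beta - kappa) ln N ^ 2], which [mertens_inequality]
    doubles. That [kappa] depends on [c] alone and not on [beta] is what allows iteration. *)
Lemma mertens_descent c : 0 < c -> c <= 1 -> exists2 kappa, 0 < kappa &
  forall beta, 4 * c <= beta ->
  (exists m0, forall m, (m0 <= m)%N -> `|mertens m| <= beta * m%:R) ->
  (exists m0, forall m, (m0 <= m)%N -> `|mertens m| <= (beta - kappa) * m%:R).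
Proof.
move=> c0 c1; have [q q1 Hq] := block_saving c0 c1.
have [C1 C10 HC1] := @mertens_inequality R.
pose kappa := c ^+ 2 / 2 / (1 + ln (2 * q)%:R).
have L0 := @ln_nat_ge0 R (2 * q).
have k0 : 0 < kappa by rewrite divr_gt0 ?divr_gt0 ?exprn_gt0// ltr_pwDl.
have kc : kappa <= c.
  rewrite ler_pdivrMr ?ltr_pwDl//; nra.
exists (kappa / 2) => [|beta cb [m0 Mb]]; first exact: divr_gt0.
have [m2 Hm2] := nat_large (2 / c).
pose a0 := maxn 1 (maxn m0 m2).
pose h j := `|mertens j| / j%:R ^+ 2 - beta / j%:R.
have [|||n m an nm|a aa|C HC] :=
  @log_decay (fun n => \sum_(1 <= j < n) h j) q a0 (c ^+ 2 / 2).
- by [].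
- by rewrite leq_max.
- by rewrite divr_gt0 ?exprn_gt0.
- have n1 : (0 < n)%N by apply: leq_trans an; rewrite leq_max.
  rewrite (big_cat_nat n1 nm)/= gerDl big_nat sumr_le0// => j /andP[nj _].
  have j0 : 0 < j%:R :> R by rewrite ltr0n (leq_trans n1).
  rewrite subr_le0 ler_pdivrMr ?exprn_gt0// expr2 mulrA divfK ?gt_eqF//.
  by apply: Mb; apply: leq_trans nj; apply: leq_trans an; rewrite !leq_max leqnn orbT.
- have a1 : (0 < a)%N by apply: leq_trans aa; rewrite leq_max.
  rewrite (big_cat_nat a1 (_ : a <= q * a)%N)/= ?leq_pmull ?(ltnW q1)//.
  rewrite lerD2l -lerN2 opprK -sumrN.
  under eq_bigr do rewrite opprB.
  apply: Hq => //.
    rewrite mulrC -ler_pdivrMr//; apply: Hm2.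
    by apply: leq_trans aa; rewrite !leq_max leqnn !orbT.
  move=> m am; apply: Mb; apply: leq_trans am; apply: leq_trans aa.
  by rewrite !leq_max leqnn orbT.
have k'0 : 0 <= beta - kappa by lra.
have b0 : 0 <= beta by lra.
pose D := `|C| + beta.
have D0 : 0 <= D by rewrite addr_ge0.
have S_le i : (0 < i)%N -> \sum_(1 <= j < i.+1) `|mertens j| / j%:R ^+ 2
    <= D + (beta - kappa) * ln i%:R.
  move=> i0; have := HC i.+1 isT; rewrite -/kappa.
  rewrite /h sumrB -mulr_sumr -/(harmonic i).
  have := ler_wpM2l b0 (@harmonic_le R i i0).
  have := ler_wpM2l (ltW k0) (@ler_ln_nat R _ _ i0 (leqnSn i)).
  by have := ler_norm C; rewrite /D; lra.
have B N : (0 < N)%N -> \sum_(1 <= j < N) `|mertens j| / j%:R ^+ 2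
    * (ln N%:R - ln j%:R) <= D * ln N%:R + (beta - kappa) / 2 * ln N%:R ^+ 2.
  case: N => // N _.
  pose S n : R := \sum_(1 <= j < n.+1) `|mertens j| / j%:R ^+ 2.
  have S0 : S 0%N = 0 by rewrite /S big_geq.
  have e := @sum_by_parts R S (fun j => ln N.+1%:R - ln j%:R) N S0; move: e.
  rewrite /= subrr mulr0 addr0 big_nat_recr//= subrr mulr0 addr0.
  move=> e.
  rewrite (_ : \sum_(1 <= j < N.+1) _ = \sum_(1 <= j < N.+1)
     (S j - S j.-1) * (ln N.+1%:R - ln j%:R)); last first.
    apply: eq_big_nat => -[//|j] _.
    congr (_ * _).
    by rewrite /S/= [in RHS]big_nat_recr//= [RHS]addrC addKr.
  rewrite e; apply: (@le_trans _ _ (\sum_(1 <= j < N.+1)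
     (D * (ln j.+1%:R - ln j%:R) +
      (beta - kappa) / 2 * (ln j.+1%:R ^+ 2 - ln j%:R ^+ 2)))).
    apply: ler_sum_nat => j /andP[j1 _]; have := S_le j j1; rewrite -/(S j).
    have := @ler_ln_nat R _ _ j1 (leqnSn j); have := @ln_nat_ge0 R j.
    move: (S j) (ln j%:R) (ln j.+1%:R) => s u v u0 uv sD.
    rewrite (_ : ln N.+1%:R - u - _ = v - u); last by ring.
    have uv' : 0 <= v - u by rewrite subr_ge0.
    have := ler_wpM2r uv' sD.
    have : (beta - kappa) * (u * (v - u)) <= (beta - kappa) * ((v ^+ 2 - u ^+ 2) / 2).
      by rewrite ler_wpM2l//; nra.
    by lra.
  rewrite big_split/= -!mulr_sumr !telescope_sumr//= ln1; lra.
pose E := 2 * D + C1.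
have E0 : 0 <= E by rewrite addr_ge0// mulr_ge0.
(* Beyond this point the lower order terms, at most [2 * E * ln N], are covered by
   [kappa / 2 * ln N ^ 2]; hence the halved gain. *)
have [N1 HN1] := ln_nat_large (1 + 4 * E / kappa).
exists (maxn 1 N1) => N; rewrite geq_max => /andP[N0 NN].
have := HC1 N N0; have := B N N0; have := HN1 N NN.
have x0 : 0 < N%:R :> R by rewrite ltr0n.
move: (`|mertens N|) (\sum_(1 <= j < N) _) => M S.
move: (ln N%:R) => l.
move: (N%:R) x0 => x x0 ll SB Mx.
have Ek : 0 <= 4 * E / kappa by apply: divr_ge0; [exact: mulr_ge0|exact: ltW].
have l1 : 1 <= l by lra.
have h1 : 2 * E * l <= kappa / 2 * l ^+ 2.
  have : 4 * E / kappa <= l by lra.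
  by rewrite ler_pdivrMr// => hl; nra.
have l2 : 0 < l ^+ 2 by rewrite exprn_gt0//; lra.
rewrite -(ler_pM2r l2); apply: le_trans Mx _.
rewrite -mulrA mulrCA ler_wpM2l ?(ltW x0)//.
have : C1 * (1 + l) <= 2 * C1 * l by nra.
have : 0 <= D * l by rewrite mulr_ge0//; lra.
by rewrite /E in h1; lra.
Qed.

(** Start from the trivial bound [beta = 1] and descend with [c = e / 4]: each step gains a fixed
    amount until [e] is reached. *)
Lemma mertens_littleo (e : R) : 0 < e ->
  exists m0, forall m, (m0 <= m)%N -> `|mertens m| <= e * m%:R.
Proof.
move=> e0; wlog e1 : e e0 / e <= 1.
  move=> H; case: (leP e 1) => [|/ltW e1]; first exact: H.
  have [m0 h] := H 1 ltr01 (lexx 1); exists m0 => m /h /le_trans; apply.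
  by rewrite ler_wpM2r.
have [||kappa k0 Hk] := @mertens_descent (e / 4); [lra|lra|].
(* Keeping [e <= beta] maintains the hypothesis [4 * c <= beta] of the descent. *)
have step n : exists2 beta, beta <= Num.max e (1 - n%:R * kappa) &
    e <= beta /\ exists m0, forall m, (m0 <= m)%N -> `|mertens m| <= beta * m%:R.
  elim: n => [|n [beta bn [eb Mb]]].
    exists 1; first by rewrite mul0r subr0 le_max lexx orbT.
    by split => //; exists 0%N => m _; rewrite mul1r norm_mertens_le.
  have [|m0 Hm0] := Hk beta _ Mb; first lra.
  exists (Num.max e (beta - kappa)).
    rewrite ge_max le_max lexx /= -natr1 mulrDl mul1r.
    move: bn; rewrite !le_max => /orP[h|h]; apply/orP; [left|right]; lra.
  split; first by rewrite le_max lexx.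
  exists m0 => m /Hm0 /le_trans; apply.
  by rewrite ler_wpM2r// le_max lexx orbT.
have [n Hn] := nat_large kappa^-1.
have [beta bn [_ [m0 Hm0]]] := step n.
exists m0 => m /Hm0 /le_trans; apply; rewrite ler_wpM2r//.
apply: le_trans bn _; rewrite ge_max lexx/=.
have := Hn n (leqnn n); rewrite -(ler_pM2r k0) mulVf ?gt_eqF//; lra.
Qed.

End MertensLittleO.

(** * Axer's theorem and rough numbers *)

Section LittleO.
Context {R : realType}.
Implicit Types (s t : nat -> R) (e : R).

Definition o_id s := forall e, 0 < e ->
  exists m0, forall N, (m0 <= N)%N -> `|s N| <= e * N%:R.

Lemma eq_o_id s t : s =1 t -> o_id s -> o_id t.
Proof. by move=> st os e /os[m0 H]; exists m0 => N /H; rewrite st. Qed.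

Lemma o_idD s t : o_id s -> o_id t -> o_id (fun N => s N + t N).
Proof.
move=> os ot e e0; have e2 : 0 < e / 2 by exact: divr_gt0.
have [m1 H1] := os _ e2; have [m2 H2] := ot _ e2.
exists (maxn m1 m2) => N; rewrite geq_max => /andP[/H1 h1 /H2 h2].
by apply: le_trans (ler_normD _ _) _; apply: le_trans (lerD h1 h2) _; lra.
Qed.

Lemma o_idZ (c : R) s : o_id s -> o_id (fun N => c * s N).
Proof.
move=> os e e0; have c1 : 0 < `|c| + 1 by rewrite ltr_wpDl.
have [m0 H] := os (e / (`|c| + 1)) (divr_gt0 e0 c1).
exists m0 => N /H; rewrite -mulrA mulrCA ler_pdivlMl// => h.
rewrite normrM; apply: le_trans h; rewrite ler_wpM2r//; lra.
Qed.

Lemma o_idB s t : o_id s -> o_id t -> o_id (fun N => s N - t N).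
Proof.
move=> os ot; apply: o_idD => //.
by apply: (@eq_o_id (fun N => -1 * t N)) => [N|]; [rewrite mulN1r|exact: o_idZ].
Qed.

(** As [N %/ p <= N / 2], a bound [e / 2 * N + m0] reproduces itself: [e / 4] comes from [t] and
    [e / 4] from the quotient. *)
Lemma o_id_divn_rec p s t : (1 < p)%N -> (forall N, `|s N| <= N%:R) ->
  o_id t -> (forall N, s N = t N + s (N %/ p)%N) -> o_id s.
Proof.
move=> p1 sN ot st e e0; have [m0 Hm0] := ot (e / 4) (divr_gt0 e0 (ltr0n _ 4)).
have p0 : (0 < p)%N by apply: ltnW.
have H N : `|s N| <= e / 2 * N%:R + m0%:R.
  elim/ltn_ind: N => N IH; case: (ltnP N m0) => [Nm|mN].
    apply: le_trans (sN N) _; have : N%:R <= m0%:R :> R by rewrite ler_nat ltnW.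
    have : 0 <= e / 2 * N%:R by rewrite mulr_ge0// divr_ge0// ltW.
    by lra.
  case: (posnP N) => [->|N0].
    by apply: le_trans (sN _) _; rewrite addr_ge0// mulr0.
  rewrite st; apply: le_trans (ler_normD _ _) _.
  have := Hm0 N mN; have := IH _ (ltn_Pdiv p1 N0).
  have : 2 * (N %/ p)%:R <= N%:R :> R.
    by rewrite -natrM ler_nat (leq_trans _ (leq_divM N p))// mulnC leq_mul2l p1 orbT.
  by move: (N%:R) ((N %/ p)%:R) => a b; nra.
have [m1 Hm1] := nat_large (2 * m0%:R / e).
exists m1 => N mN; have := Hm1 N mN; rewrite ler_pdivrMr// => h.
by apply: le_trans (H N) _; lra.
Qed.

(** Abel's inequality. The induction compares with the partial sum times the last weight, so that
    the variation of [w] telescopes. *)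
Lemma norm_sum_monotone_le (a w : nat -> R) (B : R) m n :
  (forall k, (k <= n.+1)%N -> `|\sum_(m <= j < k) a j| <= B) ->
  (forall k, (m <= k)%N -> 0 <= w k) ->
  (forall k, (m <= k)%N -> w k.+1 <= w k) -> (m <= n)%N ->
  `|\sum_(m <= j < n.+1) a j * w j| <= B * w m.
Proof.
move=> aB w0 wd mn.
have H : `|\sum_(m <= j < n.+1) a j * w j - (\sum_(m <= j < n.+1) a j) * w n|
    <= B * (w m - w n).
  elim: n mn aB => [|n IH].
    rewrite leqn0 => /eqP -> _; by rewrite !big_nat1 !subrr mulr0 normr0.
  rewrite leq_eqVlt => /predU1P[<- _|]; first by rewrite !big_nat1 !subrr mulr0 normr0.
  rewrite ltnS => mn aB.
  have {}IH := IH mn (fun k kn => aB k (leqW kn)).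
  rewrite !(@big_nat_recr _ _ _ n.+1) ?(leqW mn)//=.
  have h1 := aB n.+1 (leqnSn _); have h2 := wd n mn.
  move: IH h1; move: (\sum_(m <= j < n.+1) a j * w j) (\sum_(m <= j < n.+1) a j).
  move=> S T h3 h1.
  have -> : S + a n.+1 * w n.+1 - (T + a n.+1) * w n.+1
     = (S - T * w n) + T * (w n - w n.+1) by ring.
  apply: le_trans (ler_normD _ _) _.
  rewrite normrM [X in _ + _ * X]ger0_norm ?subr_ge0//.
  have : `|T| * (w n - w n.+1) <= B * (w n - w n.+1).
    by rewrite ler_wpM2r// subr_ge0.
  by lra.
have h : `|(\sum_(m <= j < n.+1) a j) * w n| <= B * w n.
  rewrite normrM [X in _ * X <= _]ger0_norm ?w0//.
  by rewrite ler_wpM2r ?w0// aB.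
rewrite -[X in `|X| <= _](subrK ((\sum_(m <= j < n.+1) a j) * w n)).
by apply: le_trans (ler_normD _ _) _; lra.
Qed.

(** Split at [z = N %/ K]. Below it the terms are at most 1 in size; above it the weights [N / d]
    and [N %/ d] are separately monotone and at most [K], so Abel's inequality applies with partial
    sums that are [o(N)]. *)
Lemma axer (a : nat -> R) : (forall n, `|a n| <= 1) ->
  o_id (fun N => \sum_(1 <= n < N.+1) a n) ->
  o_id (fun N => \sum_(1 <= d < N.+1) a d * (N%:R / d%:R - (N %/ d)%:R)).
Proof.
move=> a1 oA e e0.
have [K0 HK] := nat_large (2 / e); pose K := K0.+1.
have {}HK : 2 / e <= K%:R by apply: HK.
have K1 : 0 < K%:R :> R by rewrite ltr0n.
(* Partial sums beyond [z] are at most [2 e' N]; times [K] this is [e / 4 * N] for each of the two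
   weights. *)
pose e' := e / (8 * K%:R).
have e'0 : 0 < e' by rewrite divr_gt0// mulr_gt0.
have [m0 Hm0] := oA e' e'0.
have [m1 Hm1] := nat_large (m0%:R / e').
have A_le m : `|\sum_(1 <= n < m.+1) a n| <= m%:R.
  apply: le_trans (ler_norm_sum _ _ _) _.
  have -> : m%:R = \sum_(1 <= n < m.+1) 1 :> R by rewrite sumr_const_nat subn1.
  exact: ler_sum.
exists m1 => N mN; set frac := fun d : nat => N%:R / d%:R - (N %/ d)%:R : R.
have N0 : 0 <= N%:R :> R by [].
have AN m : (m <= N.+1)%N -> `|\sum_(1 <= n < m) a n| <= e' * N%:R.
  case: m => [|m] mN'; first by rewrite big_geq// normr0 mulr_ge0// ltW.
  case: (leqP m0 m) => [/Hm0 h|/ltnW mm0].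
    by apply: le_trans h _; rewrite ler_wpM2l// ?ler_nat// ltW.
  apply: le_trans (A_le m) _; have := Hm1 N mN.
  rewrite ler_pdivrMr// mulrC => h; apply: le_trans h.
  by rewrite ler_nat.
pose z := (N %/ K)%N; have zN : (z <= N)%N by exact: leq_div.
have zK : z%:R <= e / 2 * N%:R.
  have [h _] := @div_nat_bounds R N K isT; apply: le_trans h _.
  rewrite ler_pdivrMr// mulrAC -[leLHS]mul1r ler_wpM2r//.
  by move: HK; rewrite ler_pdivrMr// => h; lra.
rewrite (@big_cat_nat _ _ _ z.+1)//=; apply: le_trans (ler_normD _ _) _.
have -> : e * N%:R = e / 2 * N%:R + e / 2 * N%:R by field.
apply: lerD.
  apply: le_trans zK; apply: le_trans (ler_norm_sum _ _ _) _.
  have -> : z%:R = \sum_(1 <= n < z.+1) 1 :> R by rewrite sumr_const_nat subn1.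
  apply: ler_sum_nat => d /andP[d1 _]; have [h1 h2] := @div_nat_bounds R N d d1.
  rewrite normrM -[leRHS]mulr1 ler_pM ?a1//.
  by rewrite /frac ger0_norm ?subr_ge0// lerBlDl.
case: (ltnP z N) => [zN'|Nz]; last first.
  by rewrite big_geq// normr0 mulr_ge0// divr_ge0// ltW.
pose B := 2 * (e' * N%:R).
have PB k : (k <= N.+1)%N -> `|\sum_(z.+1 <= j < k) a j| <= B.
  move=> kN; case: (leqP z.+1 k) => [zk|/ltnW kz]; last first.
    by rewrite big_geq// normr0 /B mulr_ge0// mulr_ge0// ltW.
  have := AN k kN; rewrite (@big_cat_nat _ _ _ z.+1)//= => h1.
  have := AN z.+1 (leqW zN') => h2.
  move: h1 h2; move: (\sum_(1 <= _ < _) _) (\sum_(_ <= _ < k) _) => S T.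
  by rewrite /B !ler_norml => /andP[? ?] /andP[? ?]; lra.
have hB : B * K%:R = e / 4 * N%:R.
  by rewrite /B /e'; field; rewrite gt_eqF.
have B0 : 0 <= B by rewrite /B mulr_ge0// mulr_ge0// ltW.
have NzK : (N < K * z.+1)%N by rewrite mulnC ltn_ceil.
have T1 : `|\sum_(z.+1 <= d < N.+1) a d * (N%:R / d%:R)| <= e / 4 * N%:R.
  rewrite -hB; apply: le_trans (_ : B * (N%:R / z.+1%:R) <= _); last first.
    by rewrite ler_wpM2l// ler_pdivrMr ?ltr0n// -natrM ler_nat ltnW.
  apply: (@norm_sum_monotone_le a (fun d => N%:R / d%:R) _ _ _ PB) => // k zk.
  by rewrite ler_wpM2l// lef_pV2 ?posrE ?ltr0n// ?ler_nat// (leq_trans _ zk).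
have T2 : `|\sum_(z.+1 <= d < N.+1) a d * (N %/ d)%:R| <= e / 4 * N%:R.
  rewrite -hB; apply: le_trans (_ : B * (N %/ z.+1)%:R <= _); last first.
    by rewrite ler_wpM2l// ler_nat -ltnS ltn_divLR// (ltn_trans NzK)// ltn_mul2r ltnSn.
  apply: (@norm_sum_monotone_le a (fun d => (N %/ d)%:R) _ _ _ PB) => // k zk.
  by rewrite ler_nat leq_div2l// (leq_trans _ zk).
under eq_bigr do rewrite mulrBr.
rewrite sumrB; apply: le_trans (ler_normB _ _) _.
by apply: le_trans (lerD T1 T2) _; lra.
Qed.

End LittleO.

(** * Integers without small, or without large, prime factors *)

Definition rough (y n : nat) : bool := all (fun p => y < p)%N (primes n).

Definition smooth (y n : nat) : bool := all (fun p => p <= y)%N (primes n).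

Lemma rough0 n : rough 0 n.
Proof. by apply/allP => p; rewrite mem_primes => /andP[/prime_gt0]. Qed.

Lemma roughS y n : rough y.+1 n = rough y n && (y.+1 \notin primes n).
Proof.
apply/allP/andP => [H|[/allP H yn] p pn].
  split; first by apply/allP => p /H /ltnW.
  by apply/negP => /H; rewrite ltnn.
by rewrite ltn_neqAle H// andbT; apply: contraNneq yn => ->.
Qed.

Lemma smoothS y n : smooth y n = smooth y.+1 n && (y.+1 \notin primes n).
Proof.
apply/allP/andP => [H|[/allP H yn] p pn].
  split; first by apply/allP => p /H /leqW.
  by apply/negP => /H; rewrite ltnn.
by rewrite -ltnS ltn_neqAle H// andbT; apply: contraNneq yn => <-.
Qed.

Lemma all_primes_mul_prime (P : pred nat) p k : prime p -> (0 < k)%N -> P p ->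
  all P (primes (k * p)) = all P (primes k).
Proof.
move=> pp k0 Pp; apply/allP/allP => H q qk.
  by apply: H; rewrite primesM ?(prime_gt0 pp)// qk.
move: qk; rewrite primesM ?(prime_gt0 pp)// => /orP[/H//|].
by rewrite primes_prime// inE => /eqP->.
Qed.

Lemma smooth_le y n : (n <= y)%N -> smooth y n.
Proof.
move=> ny; apply/allP => p; rewrite mem_primes => /and3P[_ n0 pn].
exact: leq_trans (dvdn_leq n0 pn) ny.
Qed.

Section RoughSums.
Context {R : realType}.
Implicit Types (y N p : nat) (F : nat -> R).

(** One sieve step: the [y]-rough multiples of the prime [y + 1] are its products with [y]-rough
    [k]. *)
Lemma sum_roughS F y N : prime y.+1 ->
  \sum_(1 <= n < N.+1 | rough y n) F n
  = \sum_(1 <= n < N.+1 | rough y.+1 n) F n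
    + \sum_(1 <= k < (N %/ y.+1).+1 | rough y k) F (k * y.+1)%N.
Proof.
move=> pp; rewrite (bigID (fun n => (y.+1 %| n)%N))/= addrC; congr (_ + _).
  rewrite big_nat_cond [RHS]big_nat_cond; apply: eq_bigl => n.
  apply: andb_id2l => /andP[n0 _].
  by rewrite roughS mem_primes pp n0.
transitivity (\sum_(1 <= n < N.+1 | (y.+1 %| n)%N) if rough y n then F n else 0).
  by rewrite -big_mkcondr; apply: eq_bigl => n; rewrite andbC.
rewrite sum_multiples// [RHS]big_mkcond; apply: eq_big_nat => k /andP[k0 _].
by rewrite /rough all_primes_mul_prime.
Qed.

Lemma eq_rough_notprime y n : ~~ prime y.+1 -> rough y.+1 n = rough y n.
Proof. by move=> np; rewrite roughS mem_primes (negbTE np) andbT. Qed.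

(** Sieve by one prime at a time. Since [mu (p * k)] is [- mu k] or 0, the sieved sum [s] satisfies
    [s N = t N + s (N %/ p)] with [t] the sum before sieving. *)
Lemma sum_rough_mu_o y : o_id (fun N => \sum_(1 <= n < N.+1 | rough y n) mu n : R).
Proof.
elim: y => [|y IH].
  apply: eq_o_id (@mertens_littleo R) => N; apply: eq_bigl => n.
  by rewrite rough0.
case: (boolP (prime y.+1)) => [pp|np]; last first.
  by apply: eq_o_id IH => N; apply: eq_bigl => n; rewrite eq_rough_notprime.
apply: (o_id_divn_rec (prime_gt1 pp) _ IH) => N.
  apply: le_trans (ler_norm_sum _ _ _) _.
  have -> : N%:R = \sum_(1 <= n < N.+1) 1 :> R by rewrite sumr_const_nat subn1.
  rewrite big_mkcond; apply: ler_sum_nat => n _.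
  by case: ifP => _; [exact: norm_mu_le1|exact: ler01].
rewrite [X in X + _](sum_roughS _ _ pp) -addrA.
rewrite [X in _ = _ + X](_ : _ = 0) ?addr0// addrC.
rewrite [X in _ + X]big_mkcond [X in X + _]big_mkcond -big_split.
rewrite big_nat big1// => k /andP[k0 _] /=.
rewrite roughS mem_primes pp k0/= mulnC.
case: (boolP (y.+1 %| k)%N) => pk; first by rewrite mu_mul_dvd// andbF if_same addr0.
by rewrite andbT; case: ifP => _; rewrite ?addr0// mu_mul_prime// addrN.
Qed.

Lemma sum_frac_rough_mu_o y : o_id (fun N =>
  \sum_(1 <= d < N.+1 | rough y d) mu d * (N%:R / d%:R - (N %/ d)%:R) : R).
Proof.
apply: eq_o_id (@axer R (fun d => if rough y d then mu d else 0) _ _) => [N|n|].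
- by rewrite [RHS]big_mkcond; apply: eq_bigr => d _; case: ifP; rewrite ?mul0r.
- by case: ifP => _; rewrite ?normr0// norm_mu_le1.
- by apply: eq_o_id (sum_rough_mu_o y) => N; rewrite big_mkcond.
Qed.

Definition rough_density y : R :=
  \prod_(1 <= p < y.+1 | prime p) (1 - p%:R^-1).

Lemma rough_densityS y : rough_density y.+1
  = rough_density y * (if prime y.+1 then 1 - y.+1%:R^-1 else 1).
Proof.
rewrite /rough_density big_mkcond big_nat_recr//= -big_mkcond.
by congr (_ * _); apply: eq_bigl.
Qed.

Lemma rough_density_ge0 y : 0 <= rough_density y.
Proof.
rewrite /rough_density; apply: prodr_ge0 => p pp.
by rewrite subr_ge0 invf_le1 ?ler1n ?ltr0n ?(prime_gt0 pp).
Qed.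

(** Each sieve step doubles the error and adds a rounding term; [y] is fixed before [N] grows. *)
Lemma card_rough_approx y : exists C, forall N,
  `|\sum_(1 <= n < N.+1 | rough y n) 1 - rough_density y * N%:R| <= C.
Proof.
elim: y => [|y [C HC]].
  exists 0 => N; rewrite (eq_bigl predT) => [|n]; last by rewrite rough0.
  by rewrite sumr_const_nat subn1/= /rough_density big_geq// mul1r subrr normr0.
rewrite rough_densityS; case: (boolP (prime y.+1)) => [pp|np]; last first.
  exists C => N; rewrite mulr1 (eq_bigl (rough y)) => [|n]; first exact: HC.
  by rewrite eq_rough_notprime.
exists (C + C + rough_density y) => N.
have := HC N; have := HC (N %/ y.+1)%N; rewrite (sum_roughS _ N pp).
have [h1 h2] := @div_nat_bounds R N y.+1 isT.
have dy := rough_density_ge0 y.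
have h3 := ler_wpM2l dy h1; have := ler_wpM2l dy h2; rewrite mulrDr mulr1 => h4.
have -> : rough_density y * (1 - y.+1%:R^-1) * N%:R
  = rough_density y * N%:R - rough_density y * (N%:R / y.+1%:R) by ring.
move: h3 h4; move: (N%:R / y.+1%:R) (N %/ y.+1)%:R => x f h3 h4.
by rewrite !ler_norml => /andP[? ?] /andP[? ?]; apply/andP; split; lra.
Qed.

(* [rough_density y] is the inverse of the Euler product over [p <= y]. *)
Lemma sum_smooth_inv_le y N :
  rough_density y * (\sum_(1 <= n < N.+1 | smooth y n) n%:R^-1) <= 1.
Proof.
elim: y => [|y IH].
  rewrite /rough_density [X in X * _]big_geq// mul1r.
  case: N => [|N]; first by rewrite big_geq// ler01.
  rewrite big_mkcond big_ltn//= invr1 big_nat big1 ?addr0// => n /andP[n1 _].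
  case: ifP => // /allP/(_ (pdiv n)).
  by rewrite mem_primes pdiv_prime// (ltnW n1) pdiv_dvd leqNgt pdiv_gt0 => /(_ isT).
have dy := rough_density_ge0 y.
rewrite rough_densityS; case: (boolP (prime y.+1)) => [pp|np]; last first.
  rewrite mulr1 (eq_bigl (smooth y)) // => n.
  by rewrite [RHS]smoothS mem_primes (negbTE np) andbT.
apply: le_trans IH; rewrite -mulrA ler_wpM2l//.
have split_p : \sum_(1 <= n < N.+1 | smooth y.+1 n) n%:R^-1
  = \sum_(1 <= n < N.+1 | smooth y n) n%:R^-1
    + \sum_(1 <= k < (N %/ y.+1).+1 | smooth y.+1 k) (k * y.+1)%:R^-1 :> R.
  rewrite (bigID (fun n => (y.+1 %| n)%N))/= addrC; congr (_ + _).
    rewrite big_nat_cond [RHS]big_nat_cond; apply: eq_bigl => n.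
    apply: andb_id2l => /andP[n0 _].
    by rewrite [in RHS]smoothS mem_primes pp n0.
  transitivity (\sum_(1 <= n < N.+1 | (y.+1 %| n)%N)
      if smooth y.+1 n then n%:R^-1 else 0 : R).
    by rewrite -big_mkcondr; apply: eq_bigl => n; rewrite andbC.
  rewrite sum_multiples// [RHS]big_mkcond; apply: eq_big_nat => k /andP[k0 _].
  by rewrite /smooth all_primes_mul_prime.
(* Multiples of [y + 1] contribute [1 / (y + 1)] times the sum cut at [N %/ y.+1], which is
   dominated by the same multiple of the full sum. *)
rewrite mulrBl mul1r lerBlDr {1}split_p lerD2l.
rewrite mulr_sumr; apply: le_trans (_ : \sum_(1 <= k < (N %/ y.+1).+1 | smooth y.+1 k)
  y.+1%:R^-1 * k%:R^-1 <= _).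
  by apply: ler_sum => k _; rewrite natrM invfM mulrC.
have kN : ((N %/ y.+1).+1 <= N.+1)%N by rewrite ltnS leq_div.
rewrite [leRHS](@big_cat_nat _ _ _ (N %/ y.+1).+1)//= lerDl.
by apply: sumr_ge0 => k _; rewrite mulr_ge0.
Qed.

(** Every [n <= y] is [y]-smooth, so the inverse of the density is at least a harmonic sum, which
    diverges. *)
Lemma rough_density_small (e : R) : 0 < e -> exists y, rough_density y <= e.
Proof.
move=> e0; have [y0 Hy] := ln_nat_large (1 / e); exists y0.
have := sum_smooth_inv_le y0 y0; have := Hy y0 (leqnn _).
have := @sum_inv_ge R 1 y0.+1 isT isT; rewrite ln1 subr0.
rewrite [X in rough_density _ * X](_ : _ = \sum_(1 <= n < y0.+1) n%:R^-1); last first.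
  rewrite [LHS]big_nat_cond [RHS]big_nat_cond; apply: eq_bigl => n.
  by apply: andb_id2l => /andP[_]; rewrite ltnS => /smooth_le ->.
have : ln y0%:R <= ln y0.+1%:R :> R.
  by case: (y0) => [|z]; [rewrite ln0 ?ln_nat_ge0|exact: ler_ln_nat].
have := rough_density_ge0 y0.
move: (rough_density y0) (\sum_(1 <= _ < _) _) => d S.
move: (ln y0%:R) (ln y0.+1%:R) => l l'.
rewrite ler_pdivrMr// => d0 h1 h2 h3 h4.
have l0 : 0 < l by rewrite -(pmulr_lgt0 _ e0); lra.
have S0 : 0 < S by lra.
have h5 : e * l <= e * S by rewrite ler_pM2l//; lra.
rewrite leNgt; apply/negP => de.
have : e * S < d * S by rewrite ltr_pM2r.
lra.
Qed.

End RoughSums.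

(** * Alladi's duality and the two averages *)

Section AlladiDuality.
Context {R : realType}.
Implicit Types (y N p d n : nat) (B e : R).
Context (u : nat -> R).

(** The dual function in Alladi's identity; [u] will be the real or the imaginary part of [f]. *)
Definition mu_pdiv d : R := mu d * u (pdiv d).

Lemma norm_mu_pdiv_le B d : (forall n, (0 < n)%N -> `|u n| <= B) ->
  `|mu_pdiv d| <= B.
Proof.
move=> uB; rewrite /mu_pdiv normrM -[leRHS]mul1r.
by rewrite ler_pM ?norm_mu_le1// uB// pdiv_gt0.
Qed.

Lemma frac_div_bounds N d : (0 < d)%N ->
  0 <= (N%:R / d%:R - (N %/ d)%:R : R) <= 1.
Proof.
move=> d0; have [h1 h2] := @div_nat_bounds R N d d0.
by rewrite subr_ge0 h1 lerBlDl.
Qed.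

(** An integer that is [y]-rough but not [(y + 1)]-rough has least prime factor [y + 1], so
    [u (pdiv d)] is constant there. *)
Lemma sum_frac_mu_pdiv_roughS y N (w : nat -> R) :
  \sum_(1 <= d < N.+1 | rough y d) mu_pdiv d * w d
  = u y.+1 * (\sum_(1 <= d < N.+1 | rough y d) mu d * w d
              - \sum_(1 <= d < N.+1 | rough y.+1 d) mu d * w d)
    + \sum_(1 <= d < N.+1 | rough y.+1 d) mu_pdiv d * w d.
Proof.
rewrite [LHS]big_mkcond [X in X - _]big_mkcond [X in _ - X]big_mkcond.
rewrite [X in _ = _ + X]big_mkcond -sumrB mulr_sumr -big_split/=.
apply: eq_bigr => d _; rewrite roughS.
case: (boolP (rough y d)) => [/allP yd|_] /=; last by rewrite subrr mulr0 addr0.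
case: (boolP (y.+1 \in primes d)) => [yp|_] /=; last by rewrite subrr mulr0 add0r.
suff <- : pdiv d = y.+1 by rewrite /mu_pdiv; ring.
move: yp; rewrite mem_primes => /and3P[yp d0 yd'].
have d1 : (1 < d)%N by apply: leq_trans (dvdn_leq d0 yd'); exact: prime_gt1.
apply/eqP; rewrite eqn_leq pdiv_min_dvd ?prime_gt1//=.
by apply: yd; rewrite mem_primes pdiv_prime// d0 pdiv_dvd.
Qed.

(** For fixed [y], the integers with least prime factor at most [y] contribute finitely many [o(N)]
    terms. The [y]-rough ones contribute at most [B] times their number, about
    [rough_density y * N], small by the choice of [y]. *)
Lemma sum_frac_mu_pdiv_o B : (forall n, (0 < n)%N -> `|u n| <= B) ->
  o_id (fun N => \sum_(1 <= d < N.+1) mu_pdiv d * (N%:R / d%:R - (N %/ d)%:R)).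
Proof.
move=> uB; have B0 : 0 <= B by apply: le_trans (uB 1%N isT).
pose G y N := \sum_(1 <= d < N.+1 | rough y d)
  mu_pdiv d * (N%:R / d%:R - (N %/ d)%:R).
have GD y : o_id (fun N => G 0%N N - G y N).
  elim: y => [|y IH].
    by move=> e e0; exists 0%N => N _; rewrite subrr normr0 mulr_ge0// ltW.
  have := o_idD IH (o_idZ (u y.+1)
    (o_idB (@sum_frac_rough_mu_o R y) (@sum_frac_rough_mu_o R y.+1))).
  apply: eq_o_id => N; rewrite [in X in X + _]/G [X in _ - X + _]sum_frac_mu_pdiv_roughS.
  by rewrite /G; ring.
move=> e e0; have B1 : 0 < 4 * (B + 1) by rewrite mulr_gt0// ltr_wpDl.
(* The density part and the counting error [C] are each at most this fraction of [N]; [B] times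
   their sum is at most [e / 2 * N]. *)
have [y Hy] := @rough_density_small R (e / (4 * (B + 1))) (divr_gt0 e0 B1).
have [C HC] := @card_rough_approx R y.
have C0 : 0 <= C by apply: le_trans (HC 0%N).
have [m1 Hm1] := GD y (e / 2) (divr_gt0 e0 (ltr0n _ 2)).
have [m2 Hm2] := @nat_large R (C * (4 * (B + 1)) / e).
exists (maxn m1 m2) => N; rewrite geq_max => /andP[N1 N2].
have := Hm1 N N1; have -> : G 0%N N = \sum_(1 <= d < N.+1)
    mu_pdiv d * (N%:R / d%:R - (N %/ d)%:R).
  by apply: eq_bigl => d; rewrite rough0.
have GB : `|G y N| <= B * (\sum_(1 <= n < N.+1 | rough y n) 1).
  rewrite /G big_mkcond [X in _ * X]big_mkcond mulr_sumr.
  apply: le_trans (ler_norm_sum _ _ _) _; apply: ler_sum_nat => d /andP[d1 _].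
  case: ifP => _; last by rewrite normr0 mulr0.
  have /andP[h1 h2] := frac_div_bounds N d1.
  by rewrite normrM ler_pM ?norm_mu_pdiv_le// ger0_norm.
have h1 := HC N; have := Hm2 N N2; rewrite ler_pdivrMr// => h2.
have h3 : rough_density y * N%:R <= e / (4 * (B + 1)) * N%:R by rewrite ler_wpM2r.
move: GB h1; move: (\sum_(1 <= _ < _ | _) 1) (\sum_(1 <= _ < _) _) (G y N) => Ph S g.
move=> gB; rewrite ler_norml => /andP[_ h4] Sg.
have h5 : Ph <= e / (4 * (B + 1)) * N%:R + C by lra.
have h6 : C <= e / (4 * (B + 1)) * N%:R by rewrite mulrAC ler_pdivlMr// mulrC; lra.
have h7 : B * Ph <= e / 2 * N%:R.
  apply: le_trans (ler_wpM2l B0 h5) _.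
  apply: le_trans (_ : (B + 1) * (2 * (e / (4 * (B + 1)) * N%:R)) <= _).
    apply: ler_pM => //; last by lra.
    - by rewrite addr_ge0// mulr_ge0// divr_ge0// ltW.
    - by rewrite lerDl.
  by rewrite le_eqVlt; apply/orP; left; apply/eqP; field; rewrite gt_eqF// ltr_wpDl.
by rewrite -[S](subrK g); apply: le_trans (ler_normD _ _) _; lra.
Qed.

(** Pair [d] with [p * d] for [p] the largest prime factor of [n]. For [d > 1] both have the same
    least prime factor and cancel; [d = 1] leaves [u 1 - u p]. *)
Lemma sum_mu_pdiv n : (0 < n)%N -> u 1%N = 0 ->
  \sum_(1 <= d < n.+1 | (d %| n)%N) mu_pdiv d = - u (max_pdiv n).
Proof.
rewrite /mu_pdiv => n0 u1; case: (leqP n 1) => [|n1].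
  by case: n n0 => [|[|]]// _ _; rewrite big_nat1P dvd1n u1 mulr0 oppr0.
rewrite (sum_mu_divisors_prime (fun d => u (pdiv d)) (max_pdiv_prime n1)) ?max_pdiv_dvd//.
rewrite big_mkcond big_ltn//= dvd1n dvdn1 muln1 (pdiv_id (max_pdiv_prime n1)).
rewrite gtn_eqF ?prime_gt1 ?max_pdiv_prime//= mu1 u1 sub0r mul1r.
rewrite big_nat big1 ?addr0//= => d /andP[d1 dn]; case: ifP => // /andP[ddn pd].
suff -> : pdiv (max_pdiv n * d) = pdiv d by rewrite subrr mulr0.
have d0 : (0 < d)%N by apply: leq_trans d1.
have md0 : (1 < max_pdiv n * d)%N.
  by rewrite (leq_trans d1)// leq_pmull// max_pdiv_gt0.
apply/eqP; rewrite eqn_leq; apply/andP; split.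
  by apply: pdiv_min_dvd; [exact: prime_gt1 (pdiv_prime d1)|
    exact: dvdn_mull (pdiv_dvd d)].
have := pdiv_dvd (max_pdiv n * d); rewrite Euclid_dvdM ?pdiv_prime//.
case/orP => [|h]; last by apply: pdiv_min_dvd => //; exact/prime_gt1/pdiv_prime.
rewrite dvdn_prime2 ?pdiv_prime ?max_pdiv_prime// => /eqP->.
apply: max_pdiv_max; rewrite mem_primes pdiv_prime// n0.
exact: dvdn_trans (pdiv_dvd d) ddn.
Qed.

Lemma sum_max_pdiv N : u 1%N = 0 ->
  \sum_(1 <= n < N.+1) u (max_pdiv n)
  = - (\sum_(1 <= d < N.+1) mu_pdiv d * (N %/ d)%:R).
Proof.
move=> u1; rewrite -[LHS]opprK -sumrN; congr (- _).
transitivity (\sum_(1 <= n < N.+1) \sum_(1 <= d < n.+1 | (d %| n)%N) mu_pdiv d).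
  by apply: eq_big_nat => n /andP[n0 _]; rewrite sum_mu_pdiv.
rewrite (sum_hyperbola N (fun d _ => mu_pdiv d)); apply: eq_bigr => d _.
by rewrite sumr_const_nat subn1 mulr_natr.
Qed.

Lemma sum_max_pdiv_div N : u 1%N = 0 ->
  \sum_(1 <= n < N.+1) u (max_pdiv n) / n%:R
  = - (\sum_(1 <= d < N.+1) mu_pdiv d / d%:R * harmonic (N %/ d)).
Proof.
move=> u1; rewrite -[LHS]opprK -sumrN; congr (- _).
transitivity (\sum_(1 <= n < N.+1) \sum_(1 <= d < n.+1 | (d %| n)%N)
    mu_pdiv d / (d * (n %/ d))%:R).
  apply: eq_big_nat => n /andP[n0 _]; rewrite -mulNr -sum_mu_pdiv// mulr_suml.
  by apply: eq_bigr => d dn; rewrite mulnC divnK.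
rewrite (sum_hyperbola N (fun d k => mu_pdiv d / (d * k)%:R)).
apply: eq_bigr => d _; rewrite /harmonic mulr_sumr.
by apply: eq_bigr => k _; rewrite natrM invfM mulrA.
Qed.

(** With [S0], [S1], [E] as below, duality gives [- S0 + E / N] for the plain average and
    [S1 - (ln N + gamma) S0 + O(1)] for the logarithmic sum. As [S0] is bounded, it cancels from the
    difference up to [O(1 / ln N)]. *)
Lemma log_average_sub_average B : u 1%N = 0 ->
  (forall n, (0 < n)%N -> `|u n| <= B) ->
  forall e, 0 < e -> exists m0, forall N, (m0 <= N)%N ->
  `|(\sum_(1 <= n < N.+1) u (max_pdiv n) / n%:R) / harmonic N
    - N%:R^-1 * (\sum_(1 <= n < N.+1) u (max_pdiv n))
    - (ln N%:R)^-1 * (\sum_(1 <= n < N.+1) mu n * ln n%:R / n%:R * u (pdiv n))|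
  <= e.
Proof.
move=> u1 uB e e0; have B0 : 0 <= B by apply: le_trans (uB 1%N isT).
have [gamma Hg] := @harmonic_floor_asymptotics R.
(* Covers the two numerators [B * (6 + 2 * |gamma|)] and [B * (7 + 2 * |gamma|)] below. *)
pose C := B * (14 + 4 * `|gamma|).
have C0 : 0 <= C by rewrite mulr_ge0// addr_ge0// mulr_ge0.
have [m1 Hm1] := sum_frac_mu_pdiv_o uB (divr_gt0 e0 (ltr0n _ 2)).
have [m2 Hm2] := ln_nat_large (1 + 2 * C / e).
exists (maxn 1 (maxn m1 m2)) => N; rewrite !geq_max => /and3P[N0 /Hm1 N1 /Hm2 N2].
have x0 : 0 < N%:R :> R by rewrite ltr0n.
pose S0 : R := \sum_(1 <= d < N.+1) mu_pdiv d / d%:R.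
pose S1 : R := \sum_(1 <= d < N.+1) mu d * ln d%:R / d%:R * u (pdiv d).
pose E : R := \sum_(1 <= d < N.+1) mu_pdiv d * (N%:R / d%:R - (N %/ d)%:R).
pose AF : R := \sum_(1 <= n < N.+1) u (max_pdiv n).
pose LF : R := \sum_(1 <= n < N.+1) u (max_pdiv n) / n%:R.
rewrite -/S1 -/AF -/LF; rewrite -/E in N1.
have AFE : AF = - (N%:R * S0) + E.
  rewrite /AF sum_max_pdiv// /E mulr_sumr -!sumrN -big_split/=.
  by apply: eq_bigr => d _; ring.
have sumB : \sum_(1 <= n < N.+1) B = B * N%:R :> R.
  by rewrite sumr_const_nat subn1 mulr_natr.
have EB : `|E| <= B * N%:R.
  rewrite -sumB; apply: le_trans (ler_norm_sum _ _ _) _.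
  apply: ler_sum_nat => d /andP[d1 _]; have /andP[h1 h2] := frac_div_bounds N d1.
  by rewrite normrM -[leRHS]mulr1 ler_pM ?norm_mu_pdiv_le// ger0_norm.
have AFB : `|AF| <= B * N%:R.
  rewrite -sumB; apply: le_trans (ler_norm_sum _ _ _) _.
  by apply: ler_sum_nat => d /andP[d1 _]; rewrite uB ?max_pdiv_gt0.
have S0B : `|S0| <= 2 * B.
  rewrite -(ler_pM2l x0) -[X in X * `|S0|](ger0_norm (ltW x0)) -normrM.
  have -> : N%:R * S0 = E - AF by rewrite AFE; ring.
  by apply: le_trans (ler_normB _ _) _; lra.
have LFB : `|LF| <= B * harmonic N.
  rewrite /harmonic mulr_sumr; apply: le_trans (ler_norm_sum _ _ _) _.
  apply: ler_sum_nat => n /andP[n1 _].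
  by rewrite normrM normfV normr_nat ler_wpM2r ?invr_ge0// uB ?max_pdiv_gt0.
pose r := LF + (ln N%:R + gamma) * S0 - S1.
(* Here [r] is the error of replacing [harmonic (N %/ d)] by [ln (N / d) + gamma]; since
   [d * (N %/ d) >= N / 2], each [d] costs at most [4 * B / N]. *)
have rB : `|r| <= 4 * B.
  have -> : r = - (\sum_(1 <= d < N.+1) mu_pdiv d / d%:R *
      (harmonic (N %/ d) - ln (N%:R / d%:R) - gamma)).
    rewrite /r /LF sum_max_pdiv_div// /S0 /S1 mulr_sumr -!sumrN -!big_split/=.
    apply: eq_big_nat => d /andP[d1 _]; have d0 : 0 < d%:R :> R by rewrite ltr0n.
    by rewrite ln_div ?posrE// /mu_pdiv; ring.
  rewrite normrN; apply: le_trans (ler_norm_sum _ _ _) _.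
  apply: le_trans (_ : \sum_(1 <= d < N.+1) 4 * (B / N%:R) <= _); last first.
    rewrite sumr_const_nat subn1/=.
    have -> // : 4 * (B / N%:R) *+ N = 4 * B.
    by rewrite -(mulr_natr _ N); field; rewrite gt_eqF.
  apply: ler_sum_nat => d /andP[d1 dN]; have d0 : 0 < d%:R :> R by rewrite ltr0n.
  have f0 : (0 < N %/ d)%N by rewrite divn_gt0.
  have [h1 h2] := @div_nat_bounds R N d d1.
  have f1 : 1 <= (N %/ d)%:R :> R by rewrite ler1n.
  have h3 := Hg _ _ f0 h1 h2.
  rewrite normrM; apply: le_trans (_ : B / d%:R * (2 / (N %/ d)%:R) <= _).
    apply: ler_pM => //; rewrite normrM normfV normr_nat ler_wpM2r ?invr_ge0//.
    exact: norm_mu_pdiv_le.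
  have -> : B / d%:R * (2 / (N %/ d)%:R) = B * (2 / (d%:R * (N %/ d)%:R)).
    by field; rewrite !pnatr_eq0 -!lt0n d1 f0.
  rewrite [leRHS]mulrCA ler_wpM2l// ler_pdivlMr// mulrAC ler_pdivrMr ?mulr_gt0 ?ltr0n//.
  by move: h2; rewrite ler_pdivrMr//; nra.
have Hle := @harmonic_le R N N0; have Hge : ln N%:R <= harmonic N :> R.
  apply: le_trans (_ : ln N.+1%:R <= _); first exact: ler_ln_nat.
  by have := @sum_inv_ge R 1 N.+1 isT isT; rewrite ln1 subr0.
have Ce : 0 <= 2 * C / e by rewrite divr_ge0 ?mulr_ge0// ltW.
have l1 : 1 <= ln N%:R :> R by lra.
have S1E : S1 = LF + (ln N%:R + gamma) * S0 - r by rewrite /r; ring.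
have CN : C / ln N%:R <= e / 2.
  rewrite ler_pdivrMr; last by lra.
  have : 2 * C / e <= ln N%:R by lra.
  by rewrite ler_pdivrMr//; lra.
have EN : `|N%:R^-1 * E| <= e / 2.
  by rewrite normrM normfV normr_nat ler_pdivrMl// mulrC.
have CE : C = B * (14 + 4 * `|gamma|) by [].
move: (ln N%:R) (harmonic N) Hle Hge l1 S1E CN LFB => l H Hle Hge l1 S1E CN LFB.
clearbody r E AF LF S0 S1 C; have g0 := normr_ge0 gamma.
have l0 : 0 < l by lra.
have H0 : 0 < H by lra.
have Bg0 : 0 <= B * `|gamma| by rewrite mulr_ge0.
have -> : LF / H - N%:R^-1 * AF - l^-1 * S1
    = (r + (H - l - gamma) * S0) / H + S1 / H * ((l - H) / l) - N%:R^-1 * E.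
  by rewrite AFE S1E; field; rewrite !gt_eqF.
have a1 : `|r + (H - l - gamma) * S0| <= B * (6 + 2 * `|gamma|).
  apply: le_trans (ler_normD _ _) _; rewrite normrM.
  have : `|H - l - gamma| <= 1 + `|gamma|.
    apply: le_trans (ler_normB _ _) _; rewrite lerD2r ger0_norm; lra.
  move=> h; have : `|H - l - gamma| * `|S0| <= (1 + `|gamma|) * (2 * B).
    exact: ler_pM.
  by lra.
have b1 : `|(r + (H - l - gamma) * S0) / H| <= B * (6 + 2 * `|gamma|) / l.
  rewrite normrM normfV (gtr0_norm H0); apply: ler_pM => //.
    by rewrite invr_ge0 ltW.
  by rewrite lef_pV2.
have a2 : `|S1 / H| <= B * (7 + 2 * `|gamma|).
  rewrite normrM normfV (gtr0_norm H0) ler_pdivrMr// S1E.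
  apply: le_trans (ler_normB _ _) _.
  have h1 := ler_normD LF ((l + gamma) * S0).
  have h2 : `|(l + gamma) * S0| <= (l + `|gamma|) * (2 * B).
    rewrite normrM; apply: ler_pM => //; apply: le_trans (ler_normD _ _) _.
    by rewrite lerD2r gtr0_norm.
  have h3 : B * l <= B * H by rewrite ler_wpM2l.
  have h4 : B * 1 <= B * H by rewrite ler_wpM2l//; lra.
  have h5 : B * `|gamma| * 1 <= B * `|gamma| * H by rewrite ler_wpM2l//; lra.
  by lra.
have b2 : `|S1 / H * ((l - H) / l)| <= B * (7 + 2 * `|gamma|) / l.
  rewrite normrM ler_pM// normrM normfV (gtr0_norm l0) -[leRHS]mul1r.
  by rewrite ler_wpM2r ?invr_ge0 ?(ltW l0)// distrC ger0_norm; lra.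
have b3 : B * (6 + 2 * `|gamma|) / l + B * (7 + 2 * `|gamma|) / l <= C / l.
  by rewrite -mulrDl ler_pM2r ?invr_gt0// CE; lra.
apply: le_trans (ler_normB _ _) _.
have := ler_normD ((r + (H - l - gamma) * S0) / H) (S1 / H * ((l - H) / l)).
by lra.
Qed.

End AlladiDuality.

(** * Complex-valued functions *)

Local Open Scope classical_set_scope.
Local Open Scope complex_scope.

Section ComplexLimits.
Context {R : realType}.

Lemma norm_Re_le (z : R[i]) : `|complex.Re z|%:C <= `|z|.
Proof. by rewrite normc_def lecR -sqrtr_sqr ler_wsqrtr// lerDl sqr_ge0. Qed.

Lemma norm_Im_le (z : R[i]) : `|complex.Im z|%:C <= `|z|.
Proof. by rewrite normc_def lecR -sqrtr_sqr ler_wsqrtr// lerDr sqr_ge0. Qed.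

Lemma norm_complex_le (z : R[i]) : `|z| <= (`|complex.Re z| + `|complex.Im z|)%:C.
Proof.
rewrite normc_def lecR -[leRHS]ger0_norm ?addr_ge0// -sqrtr_sqr ler_wsqrtr//.
rewrite sqrrD !real_normK ?num_real// lerD2r lerDl.
by rewrite mulrn_wge0// mulr_ge0.
Qed.

Lemma Re_decomp (a b : R) : complex.Re (a%:C + 'i * b%:C) = a.
Proof. by simpc; rewrite /= ?mul0r ?mulr0 ?subr0 ?addr0. Qed.

Lemma Im_decomp (a b : R) : complex.Im (a%:C + 'i * b%:C) = b.
Proof. by simpc; rewrite /= ?mul1r ?mul0r ?mulr0 ?add0r ?addr0. Qed.

Lemma cvg0_complexP {T} {F : set_system T} {FF : Filter F} (a b : T -> R) :
  ((a x)%:C + 'i * (b x)%:C @[x --> F] --> (0 : R[i])) <->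
  (a x @[x --> F] --> (0 : R)) /\ (b x @[x --> F] --> (0 : R)).
Proof.
split=> [/cvgr0Pnorm_le H|[/cvgr0Pnorm_le H1 /cvgr0Pnorm_le H2]].
  have {}H e : 0 < e -> \forall x \near F, `|(a x)%:C + 'i * (b x)%:C| <= e%:C.
    by move=> e0; apply: H; rewrite ltcR.
  split; apply/cvgr0Pnorm_le => e /H; apply: filterS => x h; rewrite -lecR.
    by have := le_trans (norm_Re_le _) h; rewrite Re_decomp.
  by have := le_trans (norm_Im_le _) h; rewrite Im_decomp.
(* A positive element of [R[i]] is real, so [e] is the image of its real part. *)
apply/cvgr0Pnorm_le => e e0; have eR := RRe_real (gtr0_real e0).
have e2 : 0 < complex.Re e / 2 by rewrite divr_gt0// -ltcR eR.
have := H2 _ e2; have := H1 _ e2; apply: filterS2 => x h1 h2.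
apply: le_trans (norm_complex_le _) _.
by rewrite Re_decomp Im_decomp -eR lecR; lra.
Qed.

Lemma sum_complexE (f : nat -> R[i]) (c : nat -> R) (h : nat -> nat) m :
  \sum_(1 <= n < m) f (h n) * (c n)%:C
  = (\sum_(1 <= n < m) complex.Re (f (h n)) * c n)%:C
    + 'i * (\sum_(1 <= n < m) complex.Im (f (h n)) * c n)%:C.
Proof.
rewrite !rmorph_sum/= mulr_sumr -big_split/=; apply: eq_bigr => n _.
by rewrite {1}[f (h n)]complexE mulrDl !rmorphM mulrA.
Qed.

End ComplexLimits.

(** * The equivalence of the two limits for real-valued functions *)

Section RealEquivalence.
Context {R : realType}.

Definition average_gap (u : nat -> R) N : R :=
  (\sum_(1 <= n < N.+1) u (max_pdiv n) / n%:R) / harmonic N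
  - N%:R^-1 * (\sum_(1 <= n < N.+1) u (max_pdiv n)).

Definition mu_ln_sum (u : nat -> R) N : R :=
  \sum_(1 <= n < N.+1) mu n * ln n%:R / n%:R * u (pdiv n).

Lemma near_truncn (P : nat -> Prop) m0 : (forall N, (m0 <= N)%N -> P N) ->
  \forall x \near +oo_R, P (Num.truncn x).
Proof.
move=> H; have : \forall x \near +oo_R, m0%:R <= x by exact: nbhs_pinfty_ge.
by apply: filterS => x mx; apply: H; rewrite truncn_ge_nat// (le_trans _ mx).
Qed.

(** For [x >= 2] with integer part [N], [x < N + 1 <= N ^ 2]. Comparing [ln x] and [ln N] up to a
    factor 2 is enough, as the limits are 0. *)
Lemma near_ln_truncn : \forall x \near +oo_R,
  [/\ 0 < ln (Num.truncn x)%:R :> R, ln (Num.truncn x)%:R <= ln x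
    & ln x <= 2 * ln (Num.truncn x)%:R].
Proof.
have : \forall x \near +oo_R, 2%:R <= x by exact: nbhs_pinfty_ge.
apply: filterS => x x2; have x0 : 0 <= x by apply: le_trans x2.
have N2 : (2 <= Num.truncn x)%N by rewrite truncn_ge_nat.
have N0 : 0 < (Num.truncn x)%:R :> R by rewrite ltr0n (leq_trans _ N2).
split; first by rewrite ln_gt0// ltr1n.
  by rewrite ler_ln ?posrE ?truncn_le// (lt_le_trans _ x2).
rewrite mulr_natl -lnXn// ler_ln ?posrE ?exprn_gt0 ?(lt_le_trans _ x2)//.
apply: le_trans (ltW (truncnS_gt x)) _; rewrite -natrX ler_nat.
by move: N2; case: (Num.truncn x) => // n; rewrite ltnS => n1; nia.
Qed.

Lemma average_gap_cvgP (u : nat -> R) (B : R) : u 1%N = 0 ->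
  (forall n, (0 < n)%N -> `|u n| <= B) ->
  (average_gap u (Num.truncn x) @[x --> +oo_R] --> (0 : R)) <->
  ((ln x)^-1 * mu_ln_sum u (Num.truncn x) @[x --> +oo_R] --> (0 : R)).
Proof.
move=> u1 uB.
have gap e : 0 < e -> \forall x \near +oo_R,
    `|average_gap u (Num.truncn x)
      - (ln (Num.truncn x)%:R)^-1 * mu_ln_sum u (Num.truncn x)| <= e.
  move=> e0; have [m0 H] := log_average_sub_average u1 uB e0.
  exact: (@near_truncn
    (fun N => `|average_gap u N - (ln N%:R)^-1 * mu_ln_sum u N| <= e) m0).
split=> /cvgr0Pnorm_le H; apply/cvgr0Pnorm_le => e e0.
  have e2 : 0 < e / 2 by exact: divr_gt0.
  have := near_ln_truncn; have := gap _ e2; have := H _ e2.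
  apply: filterS3 => x; move: (average_gap u _) (mu_ln_sum u _) => a s h1 h2 [h3 h4 _].
  have h5 : 0 < ln x by apply: lt_le_trans h4.
  have : `|(ln (Num.truncn x)%:R)^-1 * s| <= e.
    by rewrite -[X in `|X|](subKr a); apply: le_trans (ler_normB _ _) _; lra.
  apply: le_trans; rewrite !normrM ler_wpM2r// !gtr0_norm ?invr_gt0//.
  by rewrite lef_pV2.
have e2 : 0 < e / 2 by exact: divr_gt0.
have e4 : 0 < e / 4 by exact: divr_gt0.
have := near_ln_truncn; have := gap _ e2; have := H _ e4.
apply: filterS3 => x; move: (average_gap u _) (mu_ln_sum u _) => a s h1 h2 [h3 h4 h5].
have h6 : 0 < ln x by apply: lt_le_trans h4.
have : `|(ln (Num.truncn x)%:R)^-1 * s| <= 2 * `|(ln x)^-1 * s|.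
  rewrite !normrM mulrA ler_wpM2r// !gtr0_norm ?invr_gt0//.
  by rewrite -[leLHS]mul1r ler_pdivrMr// mulrAC ler_pdivlMr// mul1r.
move=> h7; rewrite -[X in `|X|](subrK ((ln (Num.truncn x)%:R)^-1 * s)).
by apply: le_trans (ler_normD _ _) _; lra.
Qed.

End RealEquivalence.

(** * Reduction of the complex statement to real and imaginary parts *)

Theorem theorem3 (R : realType) (f : nat -> R[i])
    (f_bounded : [bounded f n | n in [set n : nat | (1 <= n)%N]])
    (f1 : f 1%N = 0) :
  ((fun x : R =>
      (\sum_(n \in pos_le x) f (max_pdiv n) / n%:R)
        / (\sum_(n \in pos_le x) (1 / n%:R : R[i]))
      - 1 / #|` fset_set (pos_le x)|%:R * \sum_(n \in pos_le x) f (max_pdiv n))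
    x @[x --> +oo] --> (0 : R[i]))
  <->
  ((fun x : R =>
      1 / (ln x)%:C
        * \sum_(n \in pos_le x)
            (moebius n)%:~R * (ln n%:R)%:C / n%:R * f (pdiv n))
    x @[x --> +oo] --> (0 : R[i])).
Proof.
pose u n := complex.Re (f n); pose v n := complex.Im (f n).
have gapE (x : R) : (\sum_(n \in pos_le x) f (max_pdiv n) / n%:R)
        / (\sum_(n \in pos_le x) (1 / n%:R : R[i]))
      - 1 / #|` fset_set (pos_le x)|%:R * \sum_(n \in pos_le x) f (max_pdiv n)
    = (average_gap u (Num.truncn x))%:C
      + 'i * (average_gap v (Num.truncn x))%:C.
  rewrite !sum_pos_leE card_pos_le.
  have -> : \sum_(1 <= n < (Num.truncn x).+1) 1 / n%:R
      = (harmonic (Num.truncn x))%:C :> R[i].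
    rewrite rmorph_sum; apply: eq_bigr => n _.
    by rewrite mul1r fmorphV rmorph_nat.
  have -> : \sum_(1 <= n < (Num.truncn x).+1) f (max_pdiv n) / n%:R
      = \sum_(1 <= n < (Num.truncn x).+1) f (max_pdiv n) * (n%:R^-1)%:C.
    by apply: eq_bigr => n _; rewrite fmorphV rmorph_nat.
  have -> : \sum_(1 <= n < (Num.truncn x).+1) f (max_pdiv n)
      = (\sum_(1 <= n < (Num.truncn x).+1) u (max_pdiv n))%:C
        + 'i * (\sum_(1 <= n < (Num.truncn x).+1) v (max_pdiv n))%:C.
    rewrite !rmorph_sum mulr_sumr -big_split; apply: eq_bigr => n _.
    exact: complexE.
  have -> : 1 / (Num.truncn x)%:R = ((Num.truncn x)%:R^-1)%:C :> R[i].
    by rewrite mul1r fmorphV rmorph_nat.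
  rewrite sum_complexE -fmorphV /average_gap !rmorphB !rmorphM/= -/(harmonic _).
  by rewrite -!/(u _) -!/(v _); ring.
have muE x : 1 / (ln x)%:C * \sum_(n \in pos_le x)
            (moebius n)%:~R * (ln n%:R)%:C / n%:R * f (pdiv n)
    = ((ln x)^-1 * mu_ln_sum u (Num.truncn x))%:C
      + 'i * ((ln x)^-1 * mu_ln_sum v (Num.truncn x))%:C.
  rewrite sum_pos_leE.
  have -> : \sum_(1 <= n < (Num.truncn x).+1)
        (moebius n)%:~R * (ln n%:R)%:C / n%:R * f (pdiv n)
      = \sum_(1 <= n < (Num.truncn x).+1) f (pdiv n) * (mu n * ln n%:R / n%:R)%:C.
    (* The range starts at 1, where [mu] and [moebius] agree. *)
    apply: eq_big_nat => -[//|n] _.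
    by rewrite mulrC !rmorphM fmorphV rmorph_nat /mu rmorph_int.
  rewrite sum_complexE mul1r -fmorphV !rmorphM/= /mu_ln_sum.
  have swap (w : nat -> R) : \sum_(1 <= n < (Num.truncn x).+1)
        w (pdiv n) * (mu n * ln n%:R / n%:R)
      = \sum_(1 <= n < (Num.truncn x).+1) mu n * ln n%:R / n%:R * w (pdiv n).
    by apply: eq_bigr => n _; rewrite mulrC.
  by rewrite (swap u) (swap v); ring.
(* Boundedness says that every number above the real [M] bounds [|f|]; [M + 1] is such a number. *)
have [M [Mreal HM]] := f_bounded.
pose B := complex.Re (M + 1).
have MB : M + 1 = B%:C by rewrite /B RRe_real// realD// real1.
have fB n : (0 < n)%N -> `|f n| <= B%:C.
  by move=> n0; rewrite -MB; apply: HM => //; rewrite ltrDl.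
have uB n : (0 < n)%N -> `|u n| <= B.
  by move=> /fB; rewrite -lecR; exact: le_trans (norm_Re_le _).
have vB n : (0 < n)%N -> `|v n| <= B.
  by move=> /fB; rewrite -lecR; exact: le_trans (norm_Im_le _).
have [ru lu] := average_gap_cvgP (congr1 (@complex.Re R) f1) uB.
have [rv lv] := average_gap_cvgP (congr1 (@complex.Im R) f1) vB.
rewrite /= (eq_cvg _ _ gapE) (eq_cvg _ _ muE).
by split=> /cvg0_complexP[hu hv]; apply/cvg0_complexP; split;
  [exact: ru|exact: rv|exact: lu|exact: lv].
Qed.
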